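(* Let $T$ be an infinite spherically symmetric tree with growth function $f$. Suppose the transit times $\{X(v) : v \in T\}$ are i.i.d. with their common distribution function $G$ satisfying $$\lim_{t \to 0} G(t)\, t^{-\alpha} = c > 0$$ for some $\alpha > 0$ (with $c$ finite). Then, with $\Gamma(\cdot)$ denoting Euler's gamma function: (i) If $f$ is nondecreasing, then there is almost surely an explosion ($\sup_n M_n < \infty$) if and only if $\sum_n f(n)^{-1/\alpha}$ converges. If the sum diverges, then almost surely $$\lim_{n \to \infty} \frac{M_n}{\sum_{j=1}^n f(j)^{-1/\alpha}} = \alpha e^{-1} \left[ c\, \Gamma(1+\alpha) \right]^{-1/\alpha}.$$ (ii) For a general growth function $f$, let $\tilde f$ be the function obtained from $f$ by the recursion given in the context. Then there is almost surely an explosion if and only if $\sum_n \tilde f(n)^{-1/\alpha}$ converges. If the sum diverges, then with probability one $$\limsup_{n \to \infty} \frac{M_n}{\sum_{j=1}^n \tilde f(j)^{-1/\alpha}} = \alpha e^{-1} \left[ c\, \Gamma(1+\alpha) \right]^{-1/\alpha}.$$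
   Context: $T$ is a tree with root $\rho$; $|v|$ is the distance from $\rho$ to $v$, and $w \leq v$ means $w$ lies on the path from $\rho$ to $v$. $T$ is spherically symmetric with growth function $f : \{1,2,3,\ldots\} \to \{1,2,3,\ldots\}$ if every vertex $v$ has exactly $f(|v|+1)$ children (neighbors farther from the root); that is, each vertex at distance $n-1$ from the root has $f(n)$ children. First-passage percolation: the nonnegative random variable $X(v)$ is the transit time across the edge connecting $v$ to its parent, and $$S(v) = \sum_{\rho < w \leq v} X(w), \qquad M_n = \min_{|v| = n} S(v),$$ where the sum is over all vertices $w \neq \rho$ on the path from $\rho$ to $v$ (including $v$). An explosion is the event that the increasing sequence $(M_n)$ is bounded; it is a tail event, so for a given tree its probability is zero or one. The function $\tilde f : \{1,2,\ldots\} \to (0,\infty)$ is defined recursively, for $n \geq 0$, by $$\tilde f(n+1) = \sup\left\{ a : \ a^m \prod_{i=1}^n \tilde f(i) \leq \prod_{i=1}^{n+m} f(i) \ \text{ for all } m \geq 1 \right\},$$ where $a$ ranges over the positive reals and the empty product is $1$; in particular $\tilde f(1) = \inf_{m \geq 1} \left(\prod_{i=1}^m f(i)\right)^{1/m}$.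
   Formalization: The limit in (i) is proved under the added assumption f(n) → ∞, and the limsup in (ii) under f̃(n) → ∞; without it they fail (f = 1, X exponential of rate 1: M_n/n → 1, not 1/e). The explosion criteria are for all f. *)

(* Defs.v *)
From HB Require Import structures.
From mathcomp Require Import all_boot all_order all_algebra.
From mathcomp Require Import all_classical all_reals all_analysis.
Set Implicit Arguments.
Unset Strict Implicit.
Unset Printing Implicit Defensive.
Import Order.TTheory GRing.Theory Num.Theory.
Import numFieldNormedType.Exports.
Local Open Scope classical_set_scope.
Local Open Scope ring_scope.

Section RootedTree.
Context {V : choiceType}.
Implicit Types (e : rel V) (rho x y v w : V).

(* The [p]'s are written as in [path]: the starting vertex is left out. *)
Definition simple_paths e x y : set (seq V) :=
  [set p | [/\ path e x p, last x p = y & uniq (x :: p)]].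

Definition is_tree e : Prop :=
  [/\ symmetric e, irreflexive e & forall x y, exists! p, simple_paths e x y p].

(* All vertices but [rho] of the path from [rho] to [v], i.e. the [w]'s such
   that rho < w <= v. *)
Definition root_path e rho v : seq V := xget [::] (simple_paths e rho v).

Definition depth e rho v : nat := size (root_path e rho v).

Definition children e rho v : set V :=
  [set w | e v w /\ (depth e rho v < depth e rho w)%N].

(* Growth functions are indexed by the positive integers; [f 0] is never
   used. *)
Definition spherically_symmetric e rho (f : nat -> nat) : Prop :=
  forall v, (children e rho v #= `I_(f (depth e rho v).+1))%card.

End RootedTree.

Section Percolation.
Context {V : choiceType} {Omega : Type} {R : realType}.
Variables (e : rel V) (rho : V) (X : V -> Omega -> R).

Definition passage_time (v : V) (omega : Omega) : R :=
  \sum_(w <- root_path e rho v) X w omega.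

(* The infimum is a minimum: the levels of the trees considered here are finite
   and nonempty. *)
Definition min_passage_time (n : nat) (omega : Omega) : R :=
  inf [set passage_time v omega | v in [set v | depth e rho v = n]].

Definition explosion (omega : Omega) : Prop :=
  has_ubound (range (min_passage_time ^~ omega)).

End Percolation.

(* Mutual independence: the product rule on every finite subfamily. *)
Definition independent_RVs {d : measure_display} {Omega : measurableType d}
    {R : realType} (P : probability Omega R) {I : choiceType}
    (X : I -> {RV P >-> R}) : Prop :=
  forall (s : seq I) (B : I -> set R), uniq s ->
    (forall i, measurable (B i)) ->
    P (\big[setI/setT]_(i <- s) (X i @^-1` B i)) =
    (\prod_(i <- s) P (X i @^-1` B i))%E.
Arguments independent_RVs {d Omega R} P {I} X.

Definition common_cdf {d : measure_display} {Omega : measurableType d}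
    {R : realType} (P : probability Omega R) {I : choiceType}
    (X : I -> {RV P >-> R}) (G : R -> R) : Prop :=
  forall i t, cdf (X i) t = (G t)%:E.
Arguments common_cdf {d Omega R} P {I} X G.

Definition Gamma {R : realType} (a : R) : R :=
  \int[lebesgue_measure]_(x in `]0, +oo[) (x `^ (a - 1) * expR (- x)).

Definition power_sum {R : realType} (alpha : R) (g : nat -> R) (n : nat) : R :=
  \sum_(1 <= j < n.+1) g j `^ (- alpha^-1).

Section TildeGrowth.
Context (R : realType).
Variable f : nat -> nat.

Definition tilde_set (n : nat) (p : R) : set R :=
  [set a | 0 < a /\ forall m, (1 <= m)%N ->
     a ^+ m * p <= \prod_(1 <= i < (n + m).+1) (f i)%:R].

(* [tilde_prod n] is the product of the first [n] values of [tilde_growth]. *)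
Fixpoint tilde_prod (n : nat) : R :=
  if n is k.+1 then tilde_prod k * sup (tilde_set k (tilde_prod k)) else 1.

Definition tilde_growth (n : nat) : R :=
  if n is k.+1 then sup (tilde_set k (tilde_prod k)) else 1.

Lemma tilde_prodE n : tilde_prod n = \prod_(1 <= i < n.+1) tilde_growth i.
Proof.
by elim: n => [|n IHn]; [rewrite big_geq|rewrite big_nat_recr//= IHn].
Qed.

Lemma tilde_growthS n : tilde_growth n.+1 =
  sup [set a : R | 0 < a /\ forall m, (1 <= m)%N ->
         a ^+ m * \prod_(1 <= i < n.+1) tilde_growth i <=
         \prod_(1 <= i < (n + m).+1) (f i)%:R].
Proof. by rewrite -tilde_prodE. Qed.

Hypothesis f_gt0 : forall n, (0 < n)%N -> (0 < f n)%N.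

Let F n : R := \prod_(1 <= i < n.+1) (f i)%:R.

Let F_le n m : (n <= m)%N -> F n <= F m.
Proof.
move=> /subnK <-; elim: (m - n)%N => // k /le_trans; apply.
rewrite addSn [leRHS]/F big_nat_recr//= ler_peMr//; first exact: prodr_ge0.
by rewrite ler1n f_gt0.
Qed.

Let tilde_set_has_sup n (p : R) :
  0 < p -> p <= F n -> has_sup (tilde_set n p).
Proof.
move=> p0 pF; split.
  by exists 1; split=> // m m0; rewrite expr1n mul1r (le_trans pF) ?F_le ?leq_addr.
exists (F n.+1 / p) => a [_ /(_ 1%N isT)].
by rewrite expr1 addn1 ler_pdivlMr.
Qed.

Let tilde_prod_bounds n : 0 < tilde_prod n <= F n.
Proof.
elim: n => [|n /andP[p0 pF]]; first by rewrite /F big_geq//= ltr01 lexx.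
have [ne ub] := tilde_set_has_sup p0 pF.
have s1 : tilde_set n (tilde_prod n) 1.
  by split=> // m m0; rewrite expr1n mul1r (le_trans pF) ?F_le ?leq_addr.
apply/andP; split=> /=.
  by rewrite mulr_gt0// (lt_le_trans ltr01)//; apply: ub_le_sup.
rewrite mulrC -ler_pdivlMr//; apply: ge_sup => // a [_ /(_ 1%N isT)].
by rewrite expr1 addn1 ler_pdivlMr.
Qed.

(* The supremum in the recursion is that of a nonempty bounded set. *)
Lemma tilde_growth_has_sup n :
  has_sup [set a : R | 0 < a /\ forall m, (1 <= m)%N ->
         a ^+ m * \prod_(1 <= i < n.+1) tilde_growth i <=
         \prod_(1 <= i < (n + m).+1) (f i)%:R].
Proof.
have /andP[p0 pF] := tilde_prod_bounds n.
by have := tilde_set_has_sup p0 pF; rewrite tilde_prodE.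
Qed.

End TildeGrowth.

(* Main.v *)
(* Write g for [tilde_growth f], p_n for the product of its first n values (the
   largest log-convex minorant of the level sizes F_n), and phi for the Laplace
   transform of a transit time: phi(lam) lam^alpha --> c Gamma(1 + alpha).

   Lower bound: with lam_j = K g(j)^(1/alpha), the expected number of paths of
   length n with sum_j lam_j X_j <= alpha n is at most
   e^(alpha n) F_n prod_j phi(lam_j), which is summable over the n at which F_n
   is close to p_n as soon as e^alpha g(j) phi(lam_j) is eventually below some
   r < 1. Since lam_j only increases at indices j with F_j = p_j, a summation by
   parts turns the bounds on sum_j lam_j X_j into a lower bound on sum_j X_j.

   Upper bound: cut the levels into blocks of fixed length L and ask the b-th
   block of a path to take time at most tau_b, proportional to
   L g(b L)^(-1/alpha). By exponential tilting, a block does so with probability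
   at least 2 g(b L)^(-L) when L is large. As F_n >= p_n, the second moment
   method started at level b0 L then yields an infinite path meeting all these
   constraints, with probability tending to 1 as b0 grows. *)

Require Import Defs.
From HB Require Import structures.
From mathcomp Require Import all_boot all_order all_algebra.
From mathcomp Require Import all_classical all_reals all_analysis.
From mathcomp Require Import measurable_realfun finmap ring lra zify.
Set Implicit Arguments.
Unset Strict Implicit.
Unset Printing Implicit Defensive.
Import Order.TTheory GRing.Theory Num.Theory.
Import numFieldNormedType.Exports.
Local Open Scope classical_set_scope.
Local Open Scope ring_scope.

(** * Paths from the root of a spherically symmetric tree *)

(** The constant comes from one threshold. As g(j) grows, e^alpha g(j) phi(lam_j) tends to e^alpha c
    Gamma(1 + alpha) K^(-alpha), so K may be any number above e (c Gamma(1 + alpha))^(1/alpha); at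
    that critical value alpha / K is the claimed limit. The upper bound tilts at the same rate, up
    to powers of some u > 1.

    From below only the levels where F_n <= q^n p_n are controlled, which is why (ii) has a limsup.
    Such levels recur for every q > 1, and all levels qualify when f is nondecreasing.

    In the second moment, two paths that separate inside a block lose only a constant factor there,
    while the spare factor 2 in each block probability makes the sum over separation levels
    geometric, of order 1 / p_(b0 L). The time spent before level b0 L is a finite random constant,
    harmless for boundedness and negligible against a divergent sum.

    If g stays bounded, the asymptotics of phi say nothing; a uniform bound on phi then excludes
    explosion with a cruder constant. *)

Section RootPaths.
Context {V : choiceType} (e : rel V) (rho : V) (f : nat -> nat).
Hypothesis tree_e : is_tree e.
Hypothesis sym_f : spherically_symmetric e rho f.
Implicit Types (v w : V) (p q : seq V).

Definition level_size (n : nat) : nat := (\prod_(1 <= i < n.+1) f i)%N.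

Let tree_uniq x y : exists! p, simple_paths e x y p.
Proof. by case: tree_e. Qed.

Lemma root_pathP v : simple_paths e rho v (root_path e rho v).
Proof. by have [p [pP _]] := tree_uniq rho v; rewrite /root_path; exact: (xgetPex [::] (ex_intro _ p pP)). Qed.

Lemma root_path_uniq v p : simple_paths e rho v p -> root_path e rho v = p.
Proof.
move=> pP; have [q [_ qU]] := tree_uniq rho v.
by rewrite -(qU _ (root_pathP v)) -(qU _ pP).
Qed.

Lemma root_path_take v n : root_path e rho (last rho (take n (root_path e rho v)))
  = take n (root_path e rho v).
Proof.
apply: root_path_uniq; have [pp _ /= /andP[r up]] := root_pathP v.
split => //; first exact: take_path.
by rewrite /= take_uniq// andbT; apply: contra r => /mem_take.
Qed.

Lemma root_path_root : root_path e rho rho = [::].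
Proof. by apply: root_path_uniq. Qed.

Lemma last_root_path v : last rho (root_path e rho v) = v.
Proof. by have [_ -> _] := root_pathP v. Qed.

(** If [w] already lay on the path to [v], its root path would be a prefix of that path, so [w]
    would not be deeper than [v]. Hence appending [w] keeps the path simple. *)
Lemma childrenP v w :
  children e rho v w <-> root_path e rho w = rcons (root_path e rho v) w.
Proof.
have [pp lp up] := root_pathP v.
split=> [[evw dvw]|Ew].
  apply: root_path_uniq; split; rewrite ?last_rcons//.
    by rewrite rcons_path pp lp.
  rewrite -rcons_cons rcons_uniq up andbT; apply: contraTN dvw => win.
  rewrite -leqNgt /depth.
  have [p1 [p2 Ew]] : exists p1 p2, root_path e rho v = p1 ++ p2 /\ w = last rho p1.
    by case: (splitPl win) => p1 p2 <-; exists p1, p2.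
  case: Ew => E Ew; have := root_path_take v (size p1).
  by rewrite {1}E take_size_cat// -Ew => ->; rewrite size_take_min geq_minr.
split; last by rewrite /depth Ew size_rcons.
have [] := root_pathP w; rewrite Ew rcons_path => /andP[_].
by rewrite lp.
Qed.

Definition kids v : seq V := enum_fset (fset_set (children e rho v)).

Lemma kids_uniq v : uniq (kids v). Proof. exact: fset_uniq. Qed.

Lemma size_kids v : size (kids v) = f (depth e rho v).+1.
Proof. by rewrite -(card_fset_set (sym_f v)). Qed.

Lemma mem_kids v w : w \in kids v <-> children e rho v w.
Proof.
have fin : finite_set (children e rho v) by apply/finite_setP; eexists; exact: sym_f.
rewrite (_ : (w \in kids v) = (w \in fset_set (children e rho v)))//.
by rewrite in_fset_set//; split=> [/set_mem|/mem_set].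
Qed.

(** Vertices of level [n] are represented by their root paths, so that the edges shared by two of
    them are read off with [take]. *)
Fixpoint paths (n : nat) : seq (seq V) :=
  if n is m.+1 then [seq rcons p w | p <- paths m, w <- kids (last rho p)]
  else [:: [::]].

Lemma mem_paths n p : p \in paths n <->
  size p = n /\ root_path e rho (last rho p) = p.
Proof.
elim: n p => [|n IHn] p /=.
  rewrite inE; split=> [/eqP ->|[/size0nil->]//]; by split=> //=; exact: root_path_root.
split=> [/allpairsPdep[q [w [qn wq ->]]]|[]].
  have [sq rq] := (IHn q).1 qn.
  by rewrite size_rcons sq last_rcons; split=> //; rewrite ((childrenP _ _).1 ((mem_kids _ _).1 wq)) rq.
case/lastP: p => // q w; rewrite size_rcons last_rcons => -[sq] rq.
have rql : root_path e rho (last rho q) = q.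
  by have := root_path_take w (size q); rewrite rq -cats1 take_size_cat// .
apply/allpairsPdep; exists q, w; split=> //; first exact/IHn.
by apply/mem_kids/childrenP; rewrite rql.
Qed.

Lemma paths_uniq n : uniq (paths n).
Proof.
elim: n => //= n IHn; apply: allpairs_uniq_dep => // [p _|[p w] [q z] _ _ /= /rcons_inj[-> ->]//].
exact: kids_uniq.
Qed.

Lemma size_paths_mem n p : p \in paths n -> size p = n.
Proof. by move=> /mem_paths[]. Qed.

Lemma take_paths n k p : (k <= n)%N -> p \in paths n -> take k p \in paths k.
Proof.
move=> kn /mem_paths[sp rp]; apply/mem_paths; split.
  by rewrite size_takel// sp.
by rewrite -[in LHS]rp root_path_take rp.
Qed.

Lemma paths_path_uniq n p : p \in paths n -> uniq p.
Proof.
by move=> /mem_paths[_ <-]; have [_ _ /= /andP[]] := root_pathP (last rho p).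
Qed.

Lemma root_path_nth n p i : p \in paths n -> (i < n)%N ->
  root_path e rho (nth rho p i) = take i.+1 p.
Proof.
move=> pn lin; have /mem_paths[sp rp] := pn.
have /mem_paths[_ <-] := take_paths lin pn.
by rewrite (take_nth rho) ?sp// last_rcons.
Qed.

(** A vertex determines its root path, hence its index. A common vertex at index [j >= k] would
    force the prefixes of length [j + 1] to agree, and with them those of length [k + 1]. *)
Lemma paths_disjoint n p q k : p \in paths n -> q \in paths n ->
  take k.+1 p != take k.+1 q -> uniq (p ++ drop k q).
Proof.
move=> pn qn pq; rewrite cat_uniq (paths_path_uniq pn) (drop_uniq _ (paths_path_uniq qn)) andbT/=.
apply/hasPn => x xq; apply/negP => xp.
have {xq}[j jn [kj xE]] : exists2 j, (j < n)%N & (k <= j)%N /\ x = nth rho q j.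
  have := xq; rewrite -index_mem size_drop (size_paths_mem qn) => h.
  exists (k + index x (drop k q))%N; first by lia.
  by rewrite leq_addr -nth_drop nth_index.
have := xp; rewrite -index_mem (size_paths_mem pn) => ip.
have := root_path_nth pn ip; rewrite nth_index// {1}xE (root_path_nth qn jn) => E.
have := f_equal size E; rewrite !size_takel ?(size_paths_mem pn) ?(size_paths_mem qn)// => -[ji].
move: E; rewrite -ji => E; move: pq => /eqP; apply.
have := f_equal (take k.+1) E; rewrite -!take_min (minn_idPl _)// -ji ltnS.
Qed.

(** By symmetry all vertices of level [k] have equally many descendants at level [n]. The product
    form avoids a division in [nat]. *)
Lemma count_extensions n k q : (k <= n)%N -> q \in paths k ->
  (count (fun p => take k p == q) (paths n) * level_size k = level_size n)%N.
Proof.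
move=> /subnK <- qk; elim: (n - k)%N => [|m IHm].
  rewrite add0n (_ : count _ _ = 1%N) ?mul1n//.
  rewrite -[RHS](_ : count_mem q (paths k) = 1%N).
    by apply: eq_in_count => p /size_paths_mem pk; rewrite -pk take_size.
  by rewrite count_uniq_mem ?paths_uniq// qk.
have -> : level_size (m.+1 + k) = (level_size (m + k) * f (m + k).+1)%N.
  by rewrite addSn /level_size big_nat_recr.
rewrite -IHm addSn /=.
rewrite mulnAC; congr muln.
rewrite count_flatten -map_comp sumnE big_map.
under eq_big_seq => p pmk.
  rewrite /= count_map (_ : count _ _ = (take k p == q) * f (m + k).+1)%N; last first.
    rewrite -(size_paths_mem pmk) -(_ : size (kids (last rho p)) = f (size p).+1); last first.
      by rewrite size_kids /depth; have /mem_paths[_ ->] := pmk.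
    rewrite (@eq_count _ _ (fun=> take k p == q)); last first.
      by move=> w /=; rewrite -cats1 takel_cat// (size_paths_mem pmk) leq_addl.
    by case: eqP => _; rewrite ?count_predT ?count_pred0 ?mul1n.
  over.
rewrite -big_distrl/= -sum1_count [in RHS]big_mkcond; congr (_ * _)%N; apply: eq_bigr => p _; case: eqP.
Qed.

Lemma size_paths n : size (paths n) = level_size n.
Proof.
have := @count_extensions n 0 [::] (leq0n _).
rewrite inE eqxx => /(_ isT); rewrite {1}/level_size big_geq// muln1 => <-.
by rewrite -[LHS]count_predT; apply: eq_count => p; rewrite take0 eqxx.
Qed.

Lemma passage_times_level {Omega : Type} {R : realType} (X : V -> Omega -> R) n omega :
  [set passage_time e rho X v omega | v in [set v | depth e rho v = n]] =
  [set \sum_(w <- p) X w omega | p in [set p | p \in paths n]].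
Proof.
apply/seteqP; split=> x.
  move=> [v /= vn <-]; exists (root_path e rho v) => //.
  by apply: (mem_paths n _).2; rewrite last_root_path.
move=> [p /= pn <-]; have /mem_paths[sp rp] := pn; exists (last rho p); last by rewrite /passage_time rp.
by rewrite /= /depth rp.
Qed.

End RootPaths.

(** * The growth function tilde f *)

Section TildeGrowthTheory.
Context (R : realType) (f : nat -> nat).
Hypothesis f_gt0 : forall n, (1 <= n)%N -> (1 <= f n)%N.

Local Notation F n := ((level_size f n)%:R : R).
Local Notation p := (tilde_prod R f).
Local Notation g := (tilde_growth R f).

Lemma level_size_le n m : (n <= m)%N -> F n <= F m.
Proof.
rewrite ler_nat => /subnK <-; elim: (m - n)%N => // k /leq_trans; apply.
by rewrite addSn [leqRHS]/level_size big_nat_recr//= leq_pmulr// f_gt0.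
Qed.

Lemma level_size_gt0 n : (0 < level_size f n)%N.
Proof. by rewrite /level_size big_nat prodn_cond_gt0// => i /andP[i0 _]; exact: f_gt0. Qed.

Lemma tilde_prodS n : p n.+1 = p n * g n.+1. Proof. by []. Qed.

Lemma tilde_growth_supP n : has_sup (tilde_set f n (p n)).
Proof.
have := tilde_growth_has_sup R f_gt0 n; rewrite -tilde_prodE.
exact.
Qed.

Lemma tilde_growth_max n (a : R) : 0 < a ->
  (forall m, (1 <= m)%N -> a ^+ m * p n <= F (n + m)) -> a <= g n.+1.
Proof.
move=> a0 am; apply: ub_le_sup; first by case: (tilde_growth_supP n).
by split=> // m m1; have := am m m1; rewrite /level_size natr_prod.
Qed.

Lemma tilde_prod_gt0_le n : 0 < p n <= F n.
Proof.
elim: n => [|n /andP[p0 pF]]; first by rewrite /level_size big_geq//= ltr01 lexx.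
have g1 : 1 <= g n.+1.
  apply: tilde_growth_max => // m m1; rewrite expr1n mul1r (le_trans pF)//.
  by rewrite level_size_le// leq_addr.
rewrite tilde_prodS mulr_gt0 ?(lt_le_trans _ g1)//= mulrC -ler_pdivlMr//.
apply: ge_sup; first by case: (tilde_growth_supP n).
move=> a [_ /(_ 1%N isT)].
by rewrite expr1 addn1 ler_pdivlMr// /level_size natr_prod.
Qed.

Lemma tilde_prod_gt0 n : 0 < p n. Proof. by case/andP: (tilde_prod_gt0_le n). Qed.
Lemma tilde_prod_le n : p n <= F n. Proof. by case/andP: (tilde_prod_gt0_le n). Qed.

Lemma tilde_growth_ge1 n : 1 <= g n.
Proof.
case: n => // n; apply: tilde_growth_max => // m m1; rewrite expr1n mul1r.
by rewrite (le_trans (tilde_prod_le n))// level_size_le// leq_addr.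
Qed.

Lemma tilde_growth_gt0 n : 0 < g n.
Proof. exact: lt_le_trans (tilde_growth_ge1 n). Qed.

(** The supremum is attained: the constraint for [m] reads [a <= y ^ (1 / m)], which passes to the
    supremum. The case [m = 0] is [p n <= F n]. *)
Lemma tilde_growth_bound n m : g n.+1 ^+ m * p n <= F (n + m).
Proof.
case: m => [|m]; first by rewrite expr0 mul1r addn0 tilde_prod_le.
rewrite -ler_pdivlMr ?tilde_prod_gt0//; set y := _ / _.
have y0 : 0 < y by rewrite divr_gt0 ?tilde_prod_gt0// ltr0n level_size_gt0.
have yE : (y `^ m.+1%:R^-1) ^+ m.+1 = y.
  by rewrite -powR_mulrn ?powR_ge0// -powRrM mulVf ?powRr1// ltW.
rewrite -[leRHS]yE lerXn2r ?nnegrE ?powR_ge0// ?(ltW (tilde_growth_gt0 _))//.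
apply: ge_sup; first by case: (tilde_growth_supP n).
move=> a [a0 /(_ m.+1 isT)]; rewrite -ler_pdivlMr ?tilde_prod_gt0// => am.
rewrite -(@ler_pXn2r _ m.+1 isT) ?nnegrE ?powR_ge0// ?(ltW a0)//.
rewrite -/y yE.
by rewrite /y /level_size natr_prod.
Qed.

(** Log-convexity of [p]: the slope [g n.+1] stays admissible one level further, since [g n.+1 ^+ m
    * p n.+1 = g n.+1 ^+ m.+1 * p n]. *)
Lemma tilde_growth_mono : {homo g : m n / (m <= n)%N >-> m <= n}.
Proof.
apply/nondecreasing_seqP => n.
case: n => [|n]; first exact: tilde_growth_ge1.
apply: tilde_growth_max => [|m m1]; first exact: tilde_growth_gt0.
rewrite tilde_prodS [_ * g _]mulrC mulrA -exprSr addSnnS.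
exact: tilde_growth_bound.
Qed.

(** The slope changes only where [p] touches [F]. Otherwise a slightly larger [a] would be
    admissible at [n]: the bound [F n.+1 / p n] settles [m = 1], and [a ^+ 2 <= g n.+1 * g n.+2]
    with [a <= g n.+2] reduces [m >= 2] to the constraints satisfied by [g n.+2]. *)
Lemma tilde_contact n : g n.+1 < g n.+2 -> F n.+1 <= p n.+1.
Proof.
move=> gg; rewrite leNgt; apply/negP => pF.
pose a := Num.min (Num.sqrt (g n.+1 * g n.+2)) (F n.+1 / p n).
have g0 := tilde_growth_gt0.
have ga : g n.+1 < a.
  rewrite lt_min; apply/andP; split.
    rewrite -[ltLHS]ger0_norm ?(ltW (g0 _))// -sqrtr_sqr ltr_sqrt ?mulr_gt0//.
    by rewrite expr2 ltr_pM2l.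
  by rewrite ltr_pdivlMr ?tilde_prod_gt0// mulrC.
have a0 : 0 < a by exact: lt_trans ga.
have a2 : a ^+ 2 <= g n.+1 * g n.+2.
  rewrite -[leRHS]sqr_sqrtr; last by rewrite mulr_ge0 ?ltW.
  by rewrite lerXn2r ?nnegrE ?sqrtr_ge0// ?(ltW a0)// ge_min lexx.
have ag : a <= g n.+2.
  rewrite -(@ler_pXn2r _ 2 isT) ?nnegrE ?(ltW a0) ?(ltW (g0 _))// (le_trans a2)//.
  by rewrite expr2 ler_wpM2r ?(ltW (g0 _))// ltW.
have := ga; rewrite ltNge => /negP; apply.
apply: tilde_growth_max => // -[//|[|m]] _.
  by rewrite expr1 addn1 -ler_pdivlMr ?tilde_prod_gt0// ge_min lexx orbT.
have := tilde_growth_bound n.+1 m.+1; rewrite addSnnS; apply: le_trans.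
rewrite tilde_prodS (exprD a 2 m) [X in _ <= X * _]exprSr.
apply: (@le_trans _ _ (g n.+1 * g n.+2 * g n.+2 ^+ m * p n)).
  rewrite ler_wpM2r ?(ltW (tilde_prod_gt0 _))// ler_pM ?exprn_ge0 ?(ltW a0)//.
  by rewrite lerXn2r ?nnegrE ?(ltW a0) ?(ltW (g0 _)).
by rewrite le_eqVlt; apply/orP; left; apply/eqP; ring.
Qed.

(** The slope [q * g n0.+1] is too large to be admissible at [n0]. The constraint it violates, for
    some [m >= 1], gives the level [n0 + m], because [g n0.+1 ^+ m * p n0 <= p (n0 + m)] by
    monotonicity. *)
Lemma tilde_almost_contact (q : R) n0 : 1 < q ->
  exists2 n, (n0 < n)%N & F n <= q ^+ n * p n.
Proof.
move=> q1; have q0 : 0 < q by exact: lt_trans q1.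
have [m m1 Fm] : exists2 m, (1 <= m)%N & F (n0 + m) < (q * g n0.+1) ^+ m * p n0.
  apply/not_exists2P => H.
  have : q * g n0.+1 <= g n0.+1.
    apply: tilde_growth_max => [|m m1]; first by rewrite mulr_gt0// tilde_growth_gt0.
    by have [//|/negP] := H m; rewrite -leNgt.
  by rewrite ger_pMl ?tilde_growth_gt0// leNgt q1.
exists (n0 + m)%N; first by lia.
apply: (le_trans (ltW Fm)); rewrite exprMn -mulrA ler_pM ?exprn_ge0 ?mulr_ge0 ?exprn_ge0 ?(ltW q0) ?(ltW (tilde_growth_gt0 _)) ?(ltW (tilde_prod_gt0 _))//.
  by rewrite ler_weXn2l ?(ltW q1)// leq_addl.
elim: m {m1 Fm} => [|m IHm]; first by rewrite addn0 expr0 mul1r.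
rewrite addnS tilde_prodS exprSr mulrAC ler_pM ?mulr_ge0 ?exprn_ge0 ?(ltW (tilde_growth_gt0 _))//.
- exact/ltW/tilde_prod_gt0.
- by rewrite tilde_growth_mono// ltnS leq_addr.
Qed.

(** For nondecreasing [f] the level sizes are already log-convex, so they are their own minorant.
    The constraint [m = 1] gives one inequality, monotonicity of [f] the other. *)
Lemma tilde_growth_nondecreasing :
  (forall m n, (1 <= m)%N -> (m <= n)%N -> (f m <= f n)%N) ->
  forall n, (1 <= n)%N -> g n = (f n)%:R.
Proof.
move=> fm; have FS n : F n.+1 = F n * (f n.+1)%:R.
  by rewrite -natrM /level_size big_nat_recr.
suff H n : p n = F n -> g n.+1 = (f n.+1)%:R.
  have pF n : p n = F n.
    by elim: n => [|n IHn]; [rewrite /level_size big_geq|rewrite tilde_prodS FS IHn H].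
  by case=> // n _; exact: H.
move=> pF; apply/eqP; rewrite eq_le; apply/andP; split.
  have := tilde_growth_bound n 1.
  by rewrite expr1 addn1 pF FS mulrC ler_pM2l// ltr0n level_size_gt0.
apply: tilde_growth_max => [|m _]; first by rewrite ltr0n; exact: f_gt0.
rewrite pF; elim: m => [|m IHm]; first by rewrite expr0 mul1r addn0.
rewrite addnS FS exprSr mulrAC ler_pM ?mulr_ge0 ?exprn_ge0//.
by rewrite ler_nat fm// ltnS leq_addr.
Qed.

End TildeGrowthTheory.

(** * Independence of disjoint subfamilies *)

Section Independence.
Context {d : measure_display} {Omega : measurableType d} {R : realType}
  (P : probability Omega R) {V : choiceType} (X : V -> {RV P >-> R}).
Hypothesis X_indep : independent_RVs P X.

Definition cylinders (s : seq V) : set (set Omega) :=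
  [set A | exists2 B : V -> set R, (forall i, measurable (B i)) &
    A = \big[setI/setT]_(i <- s) (X i @^-1` B i)].

(** The sigma-algebra generated by the [X i] with [i \in s], made a measurable space of its own so
    that the generic closure lemmas for measurable functions apply to it. *)
Definition sub_space (s : seq V) := g_sigma_algebraType (cylinders s).

Definition sub_event (s : seq V) : set (set Omega) :=
  @measurable _ (sub_space s).

Lemma cylinder_measurable s A : cylinders s A -> measurable A.
Proof.
move=> [B mB ->]; apply: big_ind => //; first exact: measurableI.
by move=> i _; rewrite -[X in measurable X]setTI; exact: measurable_funPT.
Qed.

Lemma sub_event_measurable s A : sub_event s A -> measurable A.
Proof.
apply: smallest_sub; first exact: sigma_algebra_measurable.
exact: cylinder_measurable.
Qed.

Lemma cylindersI s : setI_closed (cylinders s).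
Proof.
move=> _ _ [B1 mB1 ->] [B2 mB2 ->]; exists (fun i => B1 i `&` B2 i).
  by move=> i; exact: measurableI.
by rewrite -big_split.
Qed.

Lemma sub_measurable_RV s i : i \in s ->
  measurable_fun [set: sub_space s] (X i : sub_space s -> R).
Proof.
move=> si _ B mB; rewrite setTI; apply: sub_sigma_algebra.
exists (fun j => if j == i then B else setT); first by move=> j; case: ifP.
rewrite -bigcap_seq; apply/seteqP; split=> w /=.
  by move=> Bw j js /=; case: eqP => // ->.
by move=> /(_ i si) /=; rewrite eqxx.
Qed.

Lemma sub_eventI s A1 A2 : sub_event s A1 -> sub_event s A2 ->
  sub_event s (A1 `&` A2).
Proof. exact: (@measurableI _ (sub_space s)). Qed.

Lemma sub_eventT s : sub_event s setT.
Proof. exact: (@measurableT _ (sub_space s)). Qed.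

Lemma sub_event_mono s1 s2 : {subset s1 <= s2} -> sub_event s1 `<=` sub_event s2.
Proof.
move=> s12; apply: smallest_sub; first exact: sigma_algebra_measurable.
move=> _ [B mB ->]; rewrite big_seq; apply: (@big_ind _ (sub_event s2)) => //.
- exact: sub_eventT.
- by move=> A1 A2; exact: sub_eventI.
move=> i /s12 is2; rewrite -[X in sub_event _ X]setTI.
exact: sub_measurable_RV.
Qed.

Let cylinders_indep s1 s2 A1 A2 : uniq (s1 ++ s2) ->
  cylinders s1 A1 -> cylinders s2 A2 -> P (A1 `&` A2) = (P A1 * P A2)%E.
Proof.
move=> us [B1 mB1 ->] [B2 mB2 ->].
have [us1 us2] : uniq s1 /\ uniq s2 by move: us; rewrite cat_uniq => /and3P[].
pose B i := if i \in s1 then B1 i else B2 i.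
have mB i : measurable (B i) by rewrite /B; case: ifP.
rewrite (X_indep us1 mB1) (X_indep us2 mB2).
have := X_indep us mB; rewrite !big_cat/=.
have E1 i : i \in s1 -> B i = B1 i by rewrite /B => ->.
have E2 i : i \in s2 -> B i = B2 i.
  move: us; rewrite cat_uniq => /and3P[_ /hasPn + _] is2.
  by move=> /(_ i is2) /negbTE; rewrite /B => ->.
under eq_big_seq => i /E1 -> do [].
under [X in _ `&` X]eq_big_seq => i /E2 -> do [].
move=> ->; congr (_ * _)%E; apply: eq_big_seq.
  by move=> i /E1 ->.
by move=> i /E2 ->.
Qed.

(* A pi-lambda argument, for the measures [P (_ `&` B)] and [P B * P]. *)
Let sub_event_indep_aux s (B : set Omega) : measurable B ->
  (forall A, cylinders s A -> P (A `&` B) = (P A * P B)%E) ->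
  forall A, sub_event s A -> P (A `&` B) = (P A * P B)%E.
Proof.
move=> mB HB A.
have PB0 : 0 <= fine (P B) by rewrite fine_ge0.
have PBE : (fine (P B))%:E = P B by rewrite fineK// fin_num_measure.
pose m1 : {measure set Omega -> \bar R} := mrestr P mB.
pose m2 : {measure set Omega -> \bar R} := mscale (NngNum PB0) P.
have m2E C : m2 C = (P C * P B)%E by rewrite /m2 /= /mscale /= PBE muleC.
have HE : [set C | cylinders s C /\ C `<=` setT] = cylinders s.
  by apply/seteqP; split=> C; [case|split].
have := @g_sigma_algebra_measure_unique_trace _ R Omega (cylinders s) setT measurableT.
rewrite HE => /(_ _ _ m1 m2) H; rewrite -m2E -[LHS]/(m1 A).
apply: H => //.
- exact: cylinder_measurable.
- exact: cylindersI.
- rewrite m2E /m1 /= /mrestr setTI probability_setT.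
  by rewrite mul1e.
- by move=> C sC; rewrite m2E; exact: HB.
- by rewrite /m1 /= /mrestr setTI; exact: le_lt_trans (probability_le1 _ mB) (ltry _).
Qed.

(** The pi-lambda step is applied twice: it reduces [A1] to a cylinder for fixed [A2], then [A2] to
    a cylinder for that [A1]. *)
Lemma sub_event_indep s1 s2 A1 A2 : uniq (s1 ++ s2) ->
  sub_event s1 A1 -> sub_event s2 A2 -> P (A1 `&` A2) = (P A1 * P A2)%E.
Proof.
move=> us sA1 sA2; move: A1 sA1; apply: sub_event_indep_aux.
  exact: sub_event_measurable sA2.
move=> A1 sA1; rewrite setIC muleC; move: A2 sA2; apply: sub_event_indep_aux.
  exact: cylinder_measurable sA1.
by move=> A2 sA2; rewrite setIC muleC (cylinders_indep us).
Qed.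

End Independence.

(** * Laplace transform of the transit times *)

Section LaplaceFubini.
Context {d : measure_display} {Omega : measurableType d} {R : realType}
  (P : probability Omega R).
Local Notation leb := (@lebesgue_measure R).

Definition exp_density (x : R) : R := expR (- x) * \1_(`]0, +oo[%classic) x.

Lemma exp_density_ge0 x : 0 <= exp_density x.
Proof. by rewrite mulr_ge0 ?expR_ge0. Qed.

Lemma measurable_exp_density : measurable_fun [set: R] exp_density.
Proof.
apply: measurable_funM; last exact: measurable_indic.
by apply: measurableT_comp => //; exact: measurable_funN.
Qed.

Lemma exp_tail (t : R) : 0 <= t ->
  (\int[leb]_x (exp_density x * \1_[set x | (t <= x)%R] x)%:E = (expR (- t))%:E)%E.
Proof.
move=> t0.
transitivity (\int[leb]_(x in `]0%R, +oo[) (expR (- x) * \1_[set x | (t <= x)%R] x)%:E)%E.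
  rewrite [RHS]integral_mkcond; apply: eq_integral => x _.
  rewrite /exp_density patchE mulrAC [\1_(`]0, +oo[%classic) _]indicE.
  by case: (_ \in _); rewrite ?mulr1// mulr0.
rewrite integral_itv_obnd_cbnd; last first.
  apply: measurable_funTS; apply/measurable_EFinP/measurable_funM.
    by apply: measurableT_comp => //; exact: measurable_funN.
  apply: measurable_indic; rewrite (_ : [set x | _] = `[t, +oo[%classic)//.
  by rewrite -set_itvcy.
transitivity (\int[leb]_(x in `[t, +oo[) (expR (- x))%:E)%E.
  rewrite [LHS]integral_mkcond [RHS]integral_mkcond; apply: eq_integral => x _.
  rewrite !patchE indicE !mem_setE !in_itv/= !andbT.
  rewrite (_ : (x \in _) = (t <= x))//; have [tx|tx] := leP t x.
    by rewrite (le_trans t0 tx) mulr1.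
  by rewrite mulr0; case: ifP.
rewrite (@ge0_continuous_FTC2y _ _ (fun x => - expR (- x)) _ 0).
- by rewrite EFinN oppeK add0e.
- by move=> x _; exact: expR_ge0.
- apply: continuous_subspaceT => x.
  by apply: continuous_comp; [exact: continuousN|exact: continuous_expR].
- by rewrite -oppr0; apply: cvgN; exact: cvgr_expR.
- by move=> x _; exact: ex_derive.
- apply: cvg_at_right_filter; apply: cvgN.
  by apply: continuous_comp; [exact: continuousN|exact: continuous_expR].
- move=> x _; rewrite derive1E.
  have dx : is_derive x 1 (fun x : R => - expR (- x)) (expR (- x)).
    by apply: is_derive_eq; rewrite mulrN1 opprK.
  exact: derive_val.
Qed.

(* Fubini for [e^-T = \int_(x >= T) e^-x dx]. *)
Lemma laplace_fubini (W T : Omega -> R) :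
  measurable_fun setT W -> measurable_fun setT T ->
  (forall w, 0 <= W w) -> (forall w, 0 <= T w) ->
  (\int[P]_w (W w * expR (- T w))%:E =
   \int[leb]_x ((exp_density x)%:E * \int[P]_w (W w * \1_[set w | (T w <= x)%R] w)%:E))%E.
Proof.
move=> mW mT W0 T0.
pose A : set (Omega * R) := [set z | (T z.1 <= z.2)%R].
have mA : measurable A.
  rewrite -[A]setTI; apply: measurable_fun_le => //.
  by apply: measurableT_comp.
pose F (z : Omega * R) := (W z.1 * (exp_density z.2 * \1_A z))%:E.
have mF : measurable_fun setT F.
  apply/measurable_EFinP/measurable_funM; first exact: measurableT_comp.
  apply: measurable_funM; last exact: measurable_indic.
  by apply: measurableT_comp => //; exact: measurable_exp_density.
have F0 z : (0 <= F z)%E by rewrite lee_fin mulr_ge0// mulr_ge0// exp_density_ge0.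
have mS w : measurable [set x | (T w <= x)%R].
  by rewrite -set_itvcy.
have mS' x : measurable [set w | (T w <= x)%R].
  by rewrite -[X in measurable X]setTI; apply: measurable_fun_le.
have := @fubini_tonelli _ _ _ _ _ P leb F mF F0; set a := (LHS) => H.
transitivity a; [|rewrite H]; apply: eq_integral => z _.
  rewrite /F/=; under eq_integral do rewrite EFinM.
  rewrite ge0_integralZl_EFin//; first last.
  - apply/measurable_EFinP/measurable_funM; first exact: measurable_exp_density.
    apply: measurable_indic; exact: (mS z).
  - by move=> x _; rewrite lee_fin mulr_ge0// exp_density_ge0.
  by rewrite EFinM -exp_tail.
rewrite /F/= -ge0_integralZl_EFin ?exp_density_ge0//.
- by apply: eq_integral => w _; rewrite -EFinM mulrCA.
- by move=> w _; rewrite lee_fin mulr_ge0.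
- by apply/measurable_EFinP/measurable_funM => //; exact: measurable_indic.
Qed.

(** By Fubini in each variable, [e ^ - S] and [e ^ - T] are mixtures of indicators of level sets, so
    the product rule on level sets suffices. *)
Lemma laplace_indep (S T : Omega -> R) :
  measurable_fun setT S -> measurable_fun setT T ->
  (forall w, 0 <= S w) -> (forall w, 0 <= T w) ->
  (forall x y, P ([set w | (S w <= x)%R] `&` [set w | (T w <= y)%R]) =
    (P [set w | (S w <= x)%R] * P [set w | (T w <= y)%R])%E) ->
  (\int[P]_w (expR (- S w) * expR (- T w))%:E =
   \int[P]_w (expR (- S w))%:E * \int[P]_w (expR (- T w))%:E)%E.
Proof.
move=> mS mT S0 T0 ST.
have mle (U : Omega -> R) x : measurable_fun setT U -> measurable [set w | (U w <= x)%R].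
  by move=> mU; rewrite -[X in measurable X]setTI; apply: measurable_fun_le.
have mcdf (U : Omega -> R) : measurable_fun setT U -> measurable_fun [set: R]
    (fun x => ((exp_density x)%:E * P [set w | (U w <= x)%R])%E).
  move=> mU; apply: emeasurable_funM.
    by apply/measurable_EFinP; exact: measurable_exp_density.
  apply: (@eq_measurable_fun _ _ _ _ _ (EFin \o (fun x => fine (P [set w | (U w <= x)%R])))).
    by move=> x _; rewrite /= fineK// fin_num_measure//; exact: mle.
  apply/measurable_EFinP; apply: nondecreasing_measurable => // x y xy.
  apply: fine_le; rewrite ?fin_num_measure//; try exact: mle.
  apply: le_measure; try by apply: mem_set; exact: mle.
  by move=> w /= /le_trans; exact.
have expE (U : Omega -> R) : measurable_fun setT U -> (forall w, 0 <= U w) ->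
    (\int[P]_w (expR (- U w))%:E =
     \int[leb]_x ((exp_density x)%:E * P [set w | (U w <= x)%R]))%E.
  move=> mU U0; under eq_integral do rewrite -[expR _]mul1r.
  rewrite (@laplace_fubini (cst 1))//; apply: eq_integral => x _; congr (_ * _)%E.
  by under eq_integral do rewrite mul1r; rewrite integral_indic ?setIT//; exact: mle.
have mexp (U : Omega -> R) : measurable_fun setT U ->
    measurable_fun setT (fun w => expR (- U w)).
  by move=> mU; apply: measurableT_comp => //; exact: measurable_funN.
have fin : (\int[P]_w (expR (- S w))%:E)%E \is a fin_num.
  rewrite ge0_fin_numE; last by apply: integral_ge0 => w _; rewrite lee_fin expR_ge0.
  apply: (@le_lt_trans _ _ (\int[P]_w (cst 1%E) w)%E); last first.
    by rewrite integral_cst// mul1e (le_lt_trans (probability_le1 _ _)) ?ltry.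
  apply: (@ge0_le_integral _ _ _ P setT measurableT _ (cst 1%E)) => //.
  - by apply/measurable_EFinP/mexp.
  - by move=> w _; rewrite lee_fin -expR0 ler_expR oppr_le0.
rewrite laplace_fubini//; last exact: mexp.
rewrite (expE T)//.
rewrite -[X in (X * _)%E]fineK// -ge0_integralZl_EFin//.
- apply: eq_integral => y _; rewrite fineK// muleCA; congr (_ * _)%E.
  under eq_integral do rewrite mulrC.
  rewrite laplace_fubini//; last first.
    by apply: measurable_indic; exact: mle.
  rewrite (expE S)// -[X in (_ * X)%E]fineK ?fin_num_measure//; last exact: mle.
  rewrite -ge0_integralZr//.
  + apply: eq_integral => x _; rewrite -muleA; congr (_ * _)%E.
    transitivity (P ([set w | (S w <= x)%R] `&` [set w | (T w <= y)%R])); last first.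
      by rewrite ST ?fineK// fin_num_measure//; exact: mle.
    rewrite -[X in P X]setIT -integral_indic//; last by apply: measurableI; exact: mle.
    by apply: eq_integral => w _; rewrite mulrC indicI.
  + exact: mcdf.
  + by move=> x _; rewrite mule_ge0// lee_fin exp_density_ge0.
  + by rewrite lee_fin fine_ge0.
- by move=> x _; rewrite mule_ge0// lee_fin exp_density_ge0.
- exact: mcdf.
- by rewrite fine_ge0// integral_ge0// => w _; rewrite lee_fin expR_ge0.
Qed.

End LaplaceFubini.

Lemma powRV {R : realType} (x r : R) : 0 <= x -> (x^-1) `^ r = (x `^ r)^-1.
Proof. by move=> x0; rewrite -powR_inv1// -powRrM mulN1r powRN. Qed.

(** * Behaviour of the Laplace transform at infinity *)

Section LaplaceAsymptotics.
Context {R : realType}.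
Local Notation leb := (@lebesgue_measure R).
Variables (G : R -> R) (alpha c : R).
Hypothesis G_ge0 : forall t, 0 <= G t.
Hypothesis G_le1 : forall t, G t <= 1.
Hypothesis G_nd : {homo G : s t / s <= t}.
Hypothesis alpha_gt0 : 0 < alpha.
Hypothesis c_gt0 : 0 < c.
Hypothesis hG : G t * t `^ (- alpha) @[t --> 0^'+] --> c.

(** Integration by parts of [E e ^ (- lam X)]: the transform is expressed through the distribution
    function alone, evaluated at the scale [1 / lam] where its behaviour near 0 is known. *)
Definition laplace (lam : R) : R :=
  fine (\int[leb]_x (exp_density x * G (x / lam))%:E).

Lemma cdf_power_bound : exists2 C : R, 0 < C & forall t, 0 < t -> G t <= C * t `^ alpha.
Proof.
have : \forall t \near 0^'+, G t * t `^ (- alpha) < c + 1.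
  by apply: (cvgr_lt c hG); rewrite ltrDl.
move=> [e /= e0 He].
have ea : 0 < e `^ alpha by exact: powR_gt0.
(* [c + 1] serves on [(0, e)], where the limit applies, and [e ^ - alpha] beyond, where [G <= 1]. *)
exists (c + 1 + (e `^ alpha)^-1).
  by rewrite !addr_gt0// invr_gt0.
move=> t t0; have ta : 0 < t `^ alpha by exact: powR_gt0.
have [te|et] := ltP t e.
  have := He t; rewrite /= sub0r normrN gtr0_norm// => /(_ te t0) /ltW.
  rewrite powRN -ler_pdivlMr ?invr_gt0// invrK => /le_trans; apply.
  by rewrite ler_wpM2r ?powR_ge0// lerDl invr_ge0 powR_ge0.
rewrite (le_trans (G_le1 t))// mulrDl.
rewrite (@le_trans _ _ ((e `^ alpha)^-1 * t `^ alpha))//.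
  by rewrite mulrC ler_pdivlMr// mul1r ge0_ler_powR ?nnegrE// ltW// (lt_le_trans e0).
by rewrite lerDr mulr_ge0 ?powR_ge0// addr_ge0// ltW.
Qed.

Definition gamma_density (x : R) : R := exp_density x * x `^ alpha.

Lemma gamma_density_ge0 x : 0 <= gamma_density x.
Proof. by rewrite mulr_ge0 ?powR_ge0// exp_density_ge0. Qed.

Lemma measurable_gamma_density : measurable_fun [set: R] gamma_density.
Proof.
apply: measurable_funM; first exact: measurable_exp_density.
exact: measurable_powR.
Qed.

Lemma exp_density_le0 (x : R) : x <= 0 -> exp_density x = 0.
Proof.
move=> x0; rewrite /exp_density indicE memNset ?mulr0//=.
by rewrite in_itv/= andbT ltNge x0.
Qed.

Lemma exp_density_gt0 (x : R) : 0 < x -> exp_density x = expR (- x).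
Proof. by move=> x0; rewrite /exp_density indicE mem_set ?mulr1//= in_itv/= x0. Qed.

(** Integrability by comparison with an exponential density of rate 1/2: [x ^ alpha] is at most a
    constant times [e ^ (x / 2)], by [ln z <= z] at [z = x / (2 alpha)]. The leading 2 cancels the
    rate in the density. *)
Lemma gamma_density_bound x : gamma_density x <=
  2 * (2 * alpha) `^ alpha * exponential_pdf 2^-1 x.
Proof.
have [x0|x0] := leP x 0.
  rewrite /gamma_density exp_density_le0// mul0r mulr_ge0//.
    by rewrite mulr_ge0 ?powR_ge0.
  by rewrite exponential_pdf_ge0.
rewrite /gamma_density exp_density_gt0// exponential_pdfE ?(ltW x0)//.
rewrite mulrACA mulfV// mul1r.
have a2 : 0 < 2 * alpha by rewrite mulr_gt0.
suff : x `^ alpha <= (2 * alpha) `^ alpha * expR (x / 2).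
  move=> /(ler_wpM2l (expR_ge0 (- x))) /le_trans; apply.
  rewrite mulrCA -expRD ler_wpM2l ?powR_ge0// ler_expR; lra.
rewrite /powR !gt_eqF// -expRD ler_expR.
rewrite -lerBlDl -mulrBr -ln_div ?posrE//.
have xa : 0 < x / (2 * alpha) by rewrite divr_gt0.
apply: (@le_trans _ _ (alpha * (x / (2 * alpha)))).
  rewrite ler_wpM2l ?(ltW alpha_gt0)//.
  by have := expR_ge1Dx (ln (x / (2 * alpha))); rewrite lnK ?posrE// => ?; lra.
by rewrite le_eqVlt; apply/orP; left; apply/eqP; field; rewrite gt_eqF.
Qed.

Lemma integrable_gamma_density : leb.-integrable setT (EFin \o gamma_density).
Proof.
apply: (@le_integrable _ _ _ leb setT measurableT _
    (EFin \o (fun x => 2 * (2 * alpha) `^ alpha * exponential_pdf 2^-1 x))).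
- by apply/measurable_EFinP; exact: measurable_gamma_density.
- move=> x _ /=; rewrite !ger0_norm ?gamma_density_ge0 ?lee_fin//.
    exact: gamma_density_bound.
  by rewrite !mulr_ge0 ?powR_ge0// exponential_pdf_ge0.
- rewrite (_ : _ \o _ = fun x => ((2 * (2 * alpha) `^ alpha)%:E * (exponential_pdf 2^-1 x)%:E)%E).
    by apply: integrableZl => //; exact: integrable_exponential_pdf.
  by apply/funext => x.
Qed.

Lemma integral_gamma_density :
  (\int[leb]_x (gamma_density x)%:E = (Gamma (1 + alpha))%:E)%E.
Proof.
have E : (\int[leb]_(x in `]0%R, +oo[) (x `^ (1 + alpha - 1) * expR (- x))%:E =
    \int[leb]_x (gamma_density x)%:E)%E.
  rewrite [LHS]integral_mkcond; apply: eq_integral => x _.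
  rewrite patchE mem_setE in_itv/= andbT /gamma_density.
  have [x0|x0] := ltP 0 x; last by rewrite exp_density_le0 ?mul0r.
  by rewrite exp_density_gt0// mulrC addrC addKr.
rewrite /Gamma /Rintegral E fineK//.
exact: (integrable_fin_num measurableT integrable_gamma_density).
Qed.

(** On [[1, +oo[] the integrand is at least [e ^ - x], so the integral is at least [e ^ - 1]. *)
Lemma Gamma_gt0 : 0 < Gamma (1 + alpha).
Proof.
rewrite -lte_fin -integral_gamma_density.
apply: (@lt_le_trans _ _ (expR (- 1))%:E); first by rewrite lte_fin expR_gt0.
rewrite -exp_tail//; apply: ge0_le_integral => //.
- by move=> x _; rewrite lee_fin mulr_ge0// exp_density_ge0.
- apply/measurable_EFinP/measurable_funM; first exact: measurable_exp_density.
  by apply: measurable_indic; rewrite -set_itvcy.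
- by apply/measurable_EFinP; exact: measurable_gamma_density.
move=> x _; rewrite lee_fin ler_wpM2l ?exp_density_ge0// indicE.
have [x1|x1] := leP 1 x; last by rewrite memNset ?powR_ge0//= leNgt x1.
by rewrite mem_set//= -{1}(powRr0 x) ler_powR// ltW.
Qed.

Lemma measurable_cdf_fun (lam : R) : 0 < lam ->
  measurable_fun [set: R] (fun x => exp_density x * G (x / lam)).
Proof.
move=> l0; apply: measurable_funM; first exact: measurable_exp_density.
apply: nondecreasing_measurable => // x y xy; apply: G_nd.
by rewrite ler_pM2r// invr_gt0.
Qed.

Let laplace_integrand_le C lam x : 0 < lam ->
  (forall t, 0 < t -> G t <= C * t `^ alpha) ->
  exp_density x * G (x / lam) <= C * lam `^ (- alpha) * gamma_density x.
Proof.
move=> lam0 HC; have [x0|x0] := leP x 0.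
  by rewrite /gamma_density exp_density_le0// !mul0r mulr0.
have := HC (x / lam) (divr_gt0 x0 lam0).
move=> /(ler_wpM2l (exp_density_ge0 x)) /le_trans; apply.
rewrite powRM ?invr_ge0 ?(ltW x0) ?(ltW lam0)// powRN.
rewrite powRV ?(ltW lam0)// /gamma_density.
by rewrite le_eqVlt; apply/orP; left; apply/eqP; ring.
Qed.

Let integral_laplace_le C lam : 0 < lam ->
  (forall t, 0 < t -> G t <= C * t `^ alpha) ->
  (\int[leb]_x (exp_density x * G (x / lam))%:E <=
   (C * lam `^ (- alpha) * Gamma (1 + alpha))%:E)%E.
Proof.
move=> lam0 HC; rewrite EFinM -integral_gamma_density -ge0_integralZl_EFin//.
- apply: ge0_le_integral => //.
  + by move=> x _; rewrite lee_fin mulr_ge0// exp_density_ge0.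
  + by apply/measurable_EFinP; exact: measurable_cdf_fun.
  + apply/measurable_EFinP; apply: measurable_funM => //.
    exact: measurable_gamma_density.
  + by move=> x _; rewrite lee_fin laplace_integrand_le.
- by move=> x _; rewrite lee_fin gamma_density_ge0.
- by apply/measurable_EFinP; exact: measurable_gamma_density.
- rewrite mulr_ge0 ?powR_ge0//; have := HC 1 ltr01.
  by rewrite powR1 mulr1; apply: le_trans.
Qed.

Lemma laplaceE lam : 0 < lam ->
  ((laplace lam)%:E = \int[leb]_x (exp_density x * G (x / lam))%:E)%E.
Proof.
move=> lam0; have [C C0 HC] := cdf_power_bound.
rewrite fineK// ge0_fin_numE.
  by rewrite (le_lt_trans (integral_laplace_le lam0 HC))// ltry.
by apply: integral_ge0 => x _; rewrite lee_fin mulr_ge0// exp_density_ge0.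
Qed.

Lemma laplace_ge0 lam : 0 <= laplace lam.
Proof.
by rewrite fine_ge0// integral_ge0// => x _; rewrite lee_fin mulr_ge0// exp_density_ge0.
Qed.

(** Uniform in [lam]: this covers growth functions that stay bounded, for which [lam] does not tend
    to infinity. *)
Lemma laplace_le : exists2 C : R, 0 < C & forall lam, 0 < lam ->
  laplace lam <= C * lam `^ (- alpha).
Proof.
have [C C0 HC] := cdf_power_bound.
exists (C * Gamma (1 + alpha)); first by rewrite mulr_gt0// Gamma_gt0.
move=> lam lam0; rewrite -lee_fin laplaceE// mulrAC.
exact: integral_laplace_le.
Qed.

(** Dominated convergence: [u ^ alpha * G (x / u)] tends to [c * x ^ alpha] and is at most
    [C * x ^ alpha] by [cdf_power_bound]. *)
Lemma laplace_cvg (u : nat -> R) : (forall n, 0 < u n) -> u n @[n --> \oo] --> +oo ->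
  laplace (u n) * u n `^ alpha @[n --> \oo] --> c * Gamma (1 + alpha).
Proof.
move=> u0 uy; have [C C0 HC] := cdf_power_bound.
pose F n x := (u n `^ alpha * (exp_density x * G (x / u n)))%:E.
pose f x := (c * gamma_density x)%:E.
have mF n : measurable_fun setT (F n).
  by apply/measurable_EFinP/measurable_funM => //; exact: measurable_cdf_fun.
have mf : measurable_fun setT f.
  by apply/measurable_EFinP/measurable_funM => //; exact: measurable_gamma_density.
have ig : leb.-integrable setT (fun x => (C * gamma_density x)%:E).
  rewrite (_ : (fun x => _) = (fun x => C%:E * (gamma_density x)%:E)%E).
    by apply: integrableZl => //; exact: integrable_gamma_density.
  by apply/funext => x.
have Ff x : F n x @[n --> \oo] --> f x.
  rewrite /F /f; apply: cvg_EFin; first exact: nearW.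
  have [x0|x0] := leP x 0.
    rewrite /gamma_density exp_density_le0// mul0r mulr0.
    rewrite (_ : _ \o _ = cst 0); first exact: cvg_cst.
    by apply/funext => n /=; rewrite mul0r mulr0.
  have t0 : (x / u n) @[n --> \oo] --> 0.
    rewrite -[X in _ --> X](mulr0 x); apply: cvgM; first exact: cvg_cst.
    by apply/gtr0_cvgV0 => //; exact: nearW.
  have t0' : (x / u n) @[n --> \oo] --> 0^'+.
    move=> A HA.
    have : \forall n \near \oo, 0 < x / u n -> A (x / u n) := t0 _ HA.
    by apply: filterS => n; apply; rewrite divr_gt0.
  have := cvg_comp _ _ t0' hG => H.
  rewrite (_ : _ \o _ = (fun n => (G (x / u n) * (x / u n) `^ (- alpha)) * gamma_density x)); last first.
    apply/funext => n /=.
    rewrite powRN powRM ?invr_ge0 ?(ltW x0) ?(ltW (u0 n))// powRV ?(ltW (u0 n))//.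
    rewrite /gamma_density; field.
    by rewrite !gt_eqF// powR_gt0.
  by apply: cvgM => //; exact: cvg_cst.
have aeF : {ae leb, forall x, setT x -> F ^~ x @ \oo --> f x}.
  by apply: aeW => x _; exact: Ff.
have aeg : {ae leb, forall x n, setT x -> (`|F n x| <= (C * gamma_density x)%:E)%E}.
  apply: aeW => x n _; rewrite /F gee0_abs ?lee_fin; last first.
    by rewrite mulr_ge0 ?powR_ge0// mulr_ge0// exp_density_ge0.
  rewrite mulrC -ler_pdivlMr ?powR_gt0// -powRN [leRHS]mulrAC.
  exact: laplace_integrand_le.
have [_ _] := @dominated_convergence _ _ _ leb setT measurableT F f _ mF mf aeF ig aeg.
have intF n : (\int[leb]_x F n x = (laplace (u n) * u n `^ alpha)%:E)%E.
  rewrite mulrC EFinM laplaceE// -ge0_integralZl_EFin ?powR_ge0//.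
  - by move=> x _; rewrite lee_fin mulr_ge0// exp_density_ge0.
  - by apply/measurable_EFinP; exact: measurable_cdf_fun.
have intf : (\int[leb]_x f x = (c * Gamma (1 + alpha))%:E)%E.
  rewrite EFinM -integral_gamma_density -ge0_integralZl_EFin ?(ltW c_gt0)//.
  - by move=> x _; rewrite lee_fin gamma_density_ge0.
  - by apply/measurable_EFinP; exact: measurable_gamma_density.
rewrite intf (_ : [sequence _]_n = EFin \o (fun n => laplace (u n) * u n `^ alpha)).
  by move=> /fine_cvg.
by apply/funext => n /=; exact: intF.
Qed.

End LaplaceAsymptotics.

(** * Laplace transforms and Chernoff bounds along a path *)

Section PathLaplace.
Context {R : realType} {V : choiceType} (rho : V)
  {d : measure_display} {Omega : measurableType d} (P : probability Omega R)
  (X : V -> {RV P >-> R}) (G : R -> R).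
Hypothesis X_ge0 : forall v omega, 0 <= X v omega.
Hypothesis X_indep : independent_RVs P X.
Hypothesis X_cdf : common_cdf P X G.

Lemma prob_RV_le v t : P [set w | X v w <= t] = (G t)%:E.
Proof. by rewrite -(X_cdf v) /cdf /distribution /= /pushforward preimage_itvNyc. Qed.

Let measurable_RV_le v t : measurable [set w | X v w <= t].
Proof. by rewrite -[X in measurable X]setTI; apply: measurable_fun_le. Qed.

Lemma common_cdf_ge0 t : 0 <= G t.
Proof. by rewrite -lee_fin -(prob_RV_le rho). Qed.

Lemma common_cdf_le1 t : G t <= 1.
Proof. by rewrite -lee_fin -(prob_RV_le rho) probability_le1. Qed.

Lemma common_cdf_nd : {homo G : s t / s <= t}.
Proof.
move=> s t st; rewrite -lee_fin -!(prob_RV_le rho).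
apply: le_measure; try by apply: mem_set; exact: measurable_RV_le.
by move=> w /= /le_trans; exact.
Qed.

Lemma measurable_le_set (U : Omega -> R) x :
  measurable_fun setT U -> measurable [set w | U w <= x].
Proof. by move=> mU; rewrite -[X in measurable X]setTI; apply: measurable_fun_le. Qed.

Lemma sub_event_le s (U : Omega -> R) x :
  measurable_fun [set: sub_space X s] (U : sub_space X s -> R) ->
  sub_event X s [set w | U w <= x].
Proof.
move=> mU; rewrite /sub_event -[X in measurable X]setTI.
by apply: (@measurable_fun_le _ (sub_space X s)).
Qed.

Lemma sub_measurable_sum s n (lam : nat -> R) p :
  (n <= size p)%N -> {subset take n p <= s} ->
  measurable_fun [set: sub_space X s]
    ((fun w => \sum_(j < n) lam j * X (nth rho p j) w) : sub_space X s -> R).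
Proof.
move=> np ps; apply: (@measurable_sum _ (sub_space X s)) => j.
apply: (@measurable_funM _ (sub_space X s)); first exact: measurable_cst.
apply: sub_measurable_RV; apply: ps.
by rewrite -(nth_take _ (ltn_ord j)) mem_nth// size_takel.
Qed.

Lemma measurable_path_sum n (lam : nat -> R) p :
  measurable_fun [set: Omega] (fun w => \sum_(j < n) lam j * X (nth rho p j) w).
Proof. by apply: measurable_sum => j; exact: measurable_funM. Qed.

Hypothesis X_laplace_fin : forall lam, 0 < lam ->
  ((laplace G lam)%:E =
   \int[@lebesgue_measure R]_x (exp_density x * G (x / lam))%:E)%E.

Lemma laplace_RV v (lam : R) : 0 < lam ->
  (\int[P]_w (expR (- (lam * X v w)))%:E = (laplace G lam)%:E)%E.
Proof.
move=> lam0; under eq_integral do rewrite -[expR _]mul1r.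
rewrite (@laplace_fubini _ _ _ P (cst 1))//; last 2 first.
- exact: measurable_funM.
- by move=> w; rewrite mulr_ge0// ltW.
rewrite X_laplace_fin//; apply: eq_integral => x _; rewrite [RHS]EFinM; congr (_ * _)%E.
under eq_integral do rewrite mul1r.
rewrite (_ : [set w | _] = [set w | X v w <= x / lam]); last first.
  by apply/seteqP; split => w /=; rewrite ler_pdivlMr// mulrC.
by rewrite integral_indic// setIT; exact: prob_RV_le.
Qed.

Lemma laplace_path n (lam : nat -> R) p : (forall j, 0 < lam j) ->
  uniq p -> (n <= size p)%N ->
  (\int[P]_w (expR (- \sum_(j < n) lam j * X (nth rho p j) w))%:E =
   (\prod_(j < n) laplace G (lam j))%:E)%E.
Proof.
move=> lam0 up; elim: n => [|n IHn] np.
  under eq_integral do rewrite big_ord0 oppr0 expR0.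
  by rewrite big_ord0 integral_cst// mul1e; exact: probability_setT.
under eq_integral do rewrite big_ord_recr/= opprD expRD.
rewrite laplace_indep; first by rewrite IHn ?(ltnW np)// laplace_RV// big_ord_recr/= EFinM.
- exact: measurable_path_sum.
- exact: measurable_funM.
- by move=> w; apply: sumr_ge0 => j _; rewrite mulr_ge0// ltW.
- by move=> w; rewrite mulr_ge0// ltW.
move=> x y; apply: (sub_event_indep X_indep (s1 := take n p) (s2 := [:: nth rho p n])).
- by rewrite cats1 -take_nth// take_uniq.
- by apply: sub_event_le; apply: sub_measurable_sum; first exact: ltnW.
- apply: sub_event_le; apply: (@measurable_funM _ (sub_space X _)); first exact: measurable_cst.
  by apply: sub_measurable_RV; rewrite inE.
Qed.

Lemma path_chernoff n (lam : nat -> R) p a : (forall j, 0 < lam j) ->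
  uniq p -> (n <= size p)%N ->
  (P [set w | (\sum_(j < n) lam j * X (nth rho p j) w <= a)%R] <=
   (expR a * \prod_(j < n) laplace G (lam j))%:E)%E.
Proof.
move=> lam0 up np; rewrite EFinM -(laplace_path lam0 up np).
have mS := measurable_path_sum n lam p.
have mE := measurable_le_set a mS.
rewrite -ge0_integralZl_EFin ?expR_ge0//; last first.
  apply/measurable_EFinP; apply: measurableT_comp => //; exact: measurable_funN.
rewrite -[X in P X]setIT -integral_indic//; apply: ge0_le_integral => //.
- by apply/measurable_EFinP; exact: measurable_indic.
- apply/measurable_EFinP; apply: measurable_funM => //.
  by apply: measurableT_comp => //; exact: measurable_funN.
move=> w _; rewrite -EFinM lee_fin -expRD indicE.
have [wa|wa] := boolP (w \in _); last exact: expR_ge0.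
by rewrite -expR0 ler_expR subr_ge0; move/set_mem: wa.
Qed.

End PathLaplace.

(** * Lower bound for the passage times *)

(** Summation by parts for [D k = A k - a k + a N], with [A] the weighted partial sums:
    [x k - a / lam k] is the increment of [D] divided by [lam k]. The sign of [D k] matters only
    where [lam] jumps. The shift [a N] makes [D k >= 0] for [k <= N] without any hypothesis there,
    at the cost [a N / lam 0]. *)
Lemma abel_lower_bound {R : realType} (x lam : nat -> R) (a : R) (N n : nat) :
  (forall j, 0 < lam j) -> (forall j, lam j <= lam j.+1) ->
  (forall j, 0 <= x j) -> 0 <= a ->
  (forall k, (N <= k.+1)%N -> (k.+1 < n)%N -> lam k < lam k.+1 ->
    a * k.+1%:R <= \sum_(j < k.+1) lam j * x j) ->
  a * n%:R <= \sum_(j < n) lam j * x j ->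
  a * (\sum_(j < n) (lam j)^-1) - a * N%:R / lam 0 <= \sum_(j < n) x j.
Proof.
move=> lam0 lamS x0 a0 Hk Hn.
pose A k := \sum_(j < k) lam j * x j.
have A0 k : 0 <= A k by apply: sumr_ge0 => j _; rewrite mulr_ge0// ltW.
have AS k : A k.+1 = A k + lam k * x k by rewrite /A big_ord_recr.
pose D k := A k - a * k%:R + a * N%:R.
have DS k : D k.+1 - D k = lam k * x k - a.
  by rewrite /D AS -natr1; ring.
have D0 : D 0 = a * N%:R by rewrite /D /A big_ord0; ring.
have Dn : 0 <= D n by rewrite addr_ge0 ?subr_ge0// mulr_ge0.
have DN k : (k <= N)%N -> 0 <= D k.
  move=> kN; rewrite /D addrAC -addrA addr_ge0// -mulrBr mulr_ge0// subr_ge0.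
  by rewrite ler_nat.
have H m : (m < n)%N ->
    D m.+1 / lam m - D 0 / lam 0 <= \sum_(k < m.+1) (x k - a / lam k).
  elim: m => [_|m IHm mn].
    rewrite big_ord1 -mulrBl DS le_eqVlt; apply/orP; left; apply/eqP.
    by field; rewrite gt_eqF.
  rewrite big_ord_recr/= (le_trans _ (lerD (IHm (ltnW mn)) (lexx _)))//.
  have -> : x m.+1 - a / lam m.+1 = (D m.+2 - D m.+1) / lam m.+1.
    by rewrite DS; field; rewrite gt_eqF.
  suff : D m.+1 / lam m.+1 <= D m.+1 / lam m by lra.
  have [->//|lamm] := eqVneq (lam m) (lam m.+1).
  rewrite ler_wpM2l ?lef_pV2 ?posrE//.
  have [mN|Nm] := leqP m.+1 N; first exact: DN.
  rewrite addr_ge0 ?mulr_ge0// subr_ge0; apply: Hk => //; first exact: ltnW.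
  by rewrite lt_neqAle lamm lamS.
case: n Hk Hn H Dn => [|n] Hk Hn H Dn.
  by rewrite !big_ord0 mulr0 sub0r oppr_le0 mulr_ge0 ?mulr_ge0 ?invr_ge0 ?(ltW (lam0 _)).
have := H n (ltnSn n); rewrite big_split/= D0.
rewrite mulr_sumr sumrN.
have : 0 <= D n.+1 / lam n by rewrite divr_ge0// ltW.
lra.
Qed.

Lemma prob_bigsetU_le {d : measure_display} {T : measurableType d} {R : realType}
  (P : probability T R) (I : eqType) (s : seq I) (F : I -> set T) (x : R) :
  (forall i, measurable (F i)) -> (forall i, i \in s -> (P (F i) <= x%:E)%E) ->
  (P (\big[setU/set0]_(i <- s) F i) <= ((size s)%:R * x)%:E)%E.
Proof.
move=> mF; elim: s => [|i s IHs] Hs; first by rewrite big_nil measure0 mul0r.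
rewrite big_cons /= mulrSr mulrDl mul1r addrC EFinD (le_trans (measureU2 _ _ _))//.
  by apply: bigsetU_measurable.
rewrite leeD ?Hs ?mem_head// IHs// => j js.
by rewrite Hs// inE js orbT.
Qed.

Lemma prod_geometric_bound {R : realType} (b : nat -> R) (r : R) (N : nat) :
  0 < r -> (forall j, 0 <= b j) -> (forall j, (N <= j)%N -> b j <= r) ->
  exists2 D : R, 0 <= D & forall n, \prod_(j < n) b j <= D * r ^+ n.
Proof.
(* [D] collects the excess of the factors over [r]; it is nondecreasing and constant from [N] on. *)
move=> r0 b0 bN; pose D n := \prod_(j < n) Num.max 1 (b j / r).
have DS n : D n.+1 = D n * Num.max 1 (b n / r) by rewrite /D big_ord_recr.
have D0 n : 0 <= D n by apply: prodr_ge0 => j _; rewrite le_max ler01.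
exists (D N) => // n; apply: (@le_trans _ _ (D n * r ^+ n)).
  elim: n => [|n IHn]; first by rewrite /D !big_ord0 mul1r.
  rewrite big_ord_recr/= DS exprSr mulrACA ler_pM ?prodr_ge0//.
  by rewrite -ler_pdivrMr// le_max lexx orbT.
rewrite ler_wpM2r ?exprn_ge0 ?(ltW r0)//.
have [nN|/ltnW Nn] := leqP n N.
  rewrite -(subnK nN); elim: (N - n)%N => // k /le_trans; apply.
  by rewrite addSn DS ler_peMr// le_max lexx.
rewrite -(subnK Nn); elim: (n - N)%N => // k; apply: le_trans.
rewrite addSn DS (_ : Num.max _ _ = 1) ?mulr1//; apply/max_idPl.
by rewrite ler_pdivrMr// mul1r bN// leq_addl.
Qed.

Lemma geometric_eseries_lty {R : realType} (D r : R) : 0 <= D -> 0 < r < 1 ->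
  (\sum_(n <oo) (D * r ^+ n)%:E < +oo)%E.
Proof.
move=> D0 /andP[r0 r1].
have H : series (geometric D r) @ \oo --> D * (1 - r)^-1.
  by apply: cvg_geometric_series; rewrite gtr0_norm.
rewrite (_ : (\sum_(n <oo) _)%E = (D * (1 - r)^-1)%:E) ?ltry//.
apply/cvg_lim => //; rewrite (_ : (fun n => _) = EFin \o series (geometric D r)).
  by apply: cvg_EFin; first exact: nearW.
by apply/funext => n; rewrite /= sumEFin.
Qed.

Section LowerBound.
Context {R : realType} {V : choiceType} (e : rel V) (rho : V) (f : nat -> nat)
  {d : measure_display} {Omega : measurableType d} (P : probability Omega R)
  (X : V -> {RV P >-> R}) (G : R -> R) (alpha : R).
Hypothesis tree_e : is_tree e.
Hypothesis sym_f : spherically_symmetric e rho f.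
Hypothesis f_gt0 : forall n, (1 <= n)%N -> (1 <= f n)%N.
Hypothesis X_ge0 : forall v omega, 0 <= X v omega.
Hypothesis X_indep : independent_RVs P X.
Hypothesis X_cdf : common_cdf P X G.
Hypothesis alpha_gt0 : 0 < alpha.
Hypothesis X_laplace_fin : forall lam, 0 < lam ->
  ((laplace G lam)%:E =
   \int[@lebesgue_measure R]_x (exp_density x * G (x / lam))%:E)%E.

Local Notation g := (tilde_growth R f).
Local Notation path_time p w := (\sum_(v <- p) X v w).
Local Notation min_time := (min_passage_time e rho X).

Lemma path_time_ord n p w : p \in paths e rho n ->
  path_time p w = \sum_(j < n) X (nth rho p j) w.
Proof. by move=> /(size_paths_mem tree_e sym_f) <-; rewrite (big_nth rho) big_mkord. Qed.

Lemma paths_nonempty n : exists p, p \in paths e rho n.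
Proof.
have := size_paths tree_e sym_f n.
case: (paths e rho n) => [/=|p s _]; last by exists p; rewrite mem_head.
by move=> /esym/eqP; rewrite gtn_eqF// level_size_gt0.
Qed.

Lemma min_time_le n p w : p \in paths e rho n -> min_time n w <= path_time p w.
Proof.
move=> pn; rewrite /min_passage_time (passage_times_level tree_e sym_f).
apply: ge_inf; last by exists p.
by exists 0 => _ [q _ <-]; apply: sumr_ge0.
Qed.

Lemma min_time_ge n a w :
  (forall p, p \in paths e rho n -> a <= path_time p w) -> a <= min_time n w.
Proof.
move=> H; rewrite /min_passage_time (passage_times_level tree_e sym_f).
apply: lb_le_inf; last by move=> _ [p /= pn <-]; exact: H.
by have [p pn] := paths_nonempty n; exists (path_time p w), p.
Qed.

Lemma power_sumE n (h : nat -> R) :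
  power_sum alpha h n = \sum_(j < n) h j.+1 `^ (- alpha^-1).
Proof. by rewrite /power_sum big_add1 big_mkord. Qed.

Lemma power_sum_nd (h : nat -> R) m n : (m <= n)%N ->
  power_sum alpha h m <= power_sum alpha h n.
Proof.
move=> /subnK <-; elim: (n - m)%N => // k /le_trans; apply.
by rewrite addSn !power_sumE big_ord_recr/= lerDl powR_ge0.
Qed.

(* Union bound for the Laplace transform of [\sum_j lam_j X_j] along the paths,
   with [lam_j] proportional to [g_j ^ (1 / alpha)]. *)
Lemma passage_lower_bound (K q r : R) (N : nat) : 0 < K -> 1 <= q -> 0 < r < 1 ->
  (forall j, (N <= j)%N ->
    q * expR alpha * g j.+1 * laplace G (K * g j.+1 `^ alpha^-1) <= r) ->
  {ae P, forall w, exists (K0 : R) (N0 : nat), forall n, (N0 <= n)%N ->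
    (level_size f n)%:R <= q ^+ n * tilde_prod R f n ->
    alpha / K * power_sum alpha g n - K0 <= min_time n w}.
Proof.
move=> K0 q1 r01 HN; have /andP[r0 r1] := r01; have q0 : 0 < q by exact: lt_le_trans q1.
have ai0 : 0 < alpha^-1 by rewrite invr_gt0.
pose lam j := K * g j.+1 `^ alpha^-1.
have lam0 j : 0 < lam j by rewrite mulr_gt0// powR_gt0// tilde_growth_gt0.
have lamS j : lam j <= lam j.+1.
  rewrite ler_wpM2l ?(ltW K0)// ge0_ler_powR ?(ltW ai0)//.
  - by rewrite nnegrE ltW// tilde_growth_gt0.
  - by rewrite nnegrE ltW// tilde_growth_gt0.
  - exact: tilde_growth_mono.
(* Contribution of one level: the product of the first [n] values is q^n p_n e^(alpha n) prod_j
   phi(lam_j), which bounds the expected number of bad paths at a good level. *)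
pose b j := q * expR alpha * g j.+1 * laplace G (lam j).
have G0 := common_cdf_ge0 rho X_cdf.
have L0 l : 0 <= laplace G l by exact: laplace_ge0.
have b0 j : 0 <= b j.
  by rewrite !mulr_ge0 ?(ltW q0) ?expR_ge0 ?(ltW (tilde_growth_gt0 R f_gt0 _)).
have [D D0 HD] := prod_geometric_bound r0 b0 HN.
pose E n p := [set w | \sum_(j < n) lam j * X (nth rho p j) w <= alpha * n%:R].
have mE n p : measurable (E n p) by apply: measurable_le_set; exact: measurable_path_sum.
pose good n := (level_size f n)%:R <= q ^+ n * tilde_prod R f n.
(* At the other levels F_n is not controlled by p_n, and nothing is claimed. *)
pose Bad n := if good n then \big[setU/set0]_(p <- paths e rho n) E n p else set0.
have mBad n : measurable (Bad n).
  by rewrite /Bad; case: ifP => // _; exact: bigsetU_measurable.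
have PBad n : (P (Bad n) <= (D * r ^+ n)%:E)%E.
  rewrite /Bad; case: ifP => [gn|_]; last first.
    by rewrite measure0 lee_fin mulr_ge0// exprn_ge0// ltW.
  have H p : p \in paths e rho n -> (P (E n p) <= (expR (alpha * n%:R) * \prod_(j < n) laplace G (lam j))%:E)%E.
    move=> pn; apply: path_chernoff => //.
      exact: (paths_path_uniq tree_e sym_f pn).
    by rewrite (size_paths_mem tree_e sym_f pn).
  apply: (le_trans (prob_bigsetU_le (mE n) H)); rewrite lee_fin.
  rewrite (size_paths tree_e sym_f) (le_trans _ (HD n))//.
  have -> : \prod_(j < n) b j = q ^+ n * tilde_prod R f n * (expR (alpha * n%:R) * \prod_(j < n) laplace G (lam j)).
    rewrite /b !big_split/= !prodr_const !card_ord expRM_natr.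
    rewrite (_ : tilde_prod R f n = \prod_(j < n) g j.+1); first by ring.
    by rewrite tilde_prodE big_add1 big_mkord.
  by rewrite ler_wpM2r// mulr_ge0 ?expR_ge0// prodr_ge0.
exists (lim_sup_set Bad); split.
- by apply: bigcap_measurable => // n _; exact: bigcup_measurable.
- apply: lim_sup_set_cvg0 => //.
  apply: le_lt_trans (geometric_eseries_lty D0 r01).
  by apply: lee_nneseries => // n _; exact: PBad.
move=> w /= H; apply: contrapT => Hw; apply: H.
have [N0 HN0] : exists N0, forall n, (N0 <= n)%N -> ~ Bad n w.
  apply/not_existsP => H; apply: Hw => n _.
  have /existsNP[k /not_implyP[nk /contrapT Bk]] := H n.
  by exists k.
exists (alpha * N0%:R / lam 0), N0 => n N0n gn; apply: min_time_ge => p pn.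
have NE k : (N0 <= k)%N -> (k <= n)%N -> good k ->
    alpha * k%:R <= \sum_(j < k) lam j * X (nth rho p j) w.
  move=> N0k kn gk; rewrite leNgt; apply/negP => Hlt; apply: (HN0 k N0k).
  rewrite /Bad gk -bigcup_seq; exists (take k p) => /=.
    exact: (take_paths tree_e sym_f kn pn).
  rewrite /E /=; apply/ltW; rewrite (eq_bigr (fun j : 'I_k => lam j * X (nth rho p j) w))// => j _.
  by rewrite nth_take.
have := @abel_lower_bound _ (fun j => X (nth rho p j) w) lam alpha N0 n lam0 lamS.
move=> /(_ (fun j => X_ge0 _ _) (ltW alpha_gt0)).
rewrite -(path_time_ord w pn) (_ : \sum_(j < n) (lam j)^-1 = K^-1 * power_sum alpha g n); last first.
  rewrite power_sumE mulr_sumr; apply: eq_bigr => j _.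
  by rewrite /lam invfM powRN.
rewrite mulrA; apply; last exact: NE.
move=> k N0k kn lamk; apply: NE => //; first exact: ltnW.
(* [lam] jumps only at contact levels, and these are good for every [q >= 1]. *)
rewrite /good (le_trans (tilde_contact f_gt0 _))//.
  rewrite ltNge; apply: contraTN lamk => gk; rewrite -leNgt.
  rewrite ler_wpM2l ?(ltW K0)// ge0_ler_powR ?(ltW ai0)//.
  - by rewrite nnegrE ltW// tilde_growth_gt0.
  - by rewrite nnegrE ltW// tilde_growth_gt0.
rewrite ler_peMl ?exprn_ege1//.
exact/ltW/tilde_prod_gt0.
Qed.

End LowerBound.

(** * Upper bound for the passage times *)

Section SecondMoment.
Context {d : measure_display} {T : measurableType d} {R : realType}
  (P : probability T R).

Lemma integral_indic_sum (I : Type) (s : seq I) (a : I -> R) (A : I -> set T) :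
  (forall i, 0 <= a i) -> (forall i, measurable (A i)) ->
  (\int[P]_w (\sum_(i <- s) a i * \1_(A i) w)%:E =
   (\sum_(i <- s) a i * fine (P (A i)))%:E)%E.
Proof.
move=> a0 mA; under eq_integral do rewrite -sumEFin.
rewrite ge0_integral_sum//; last 2 first.
- by move=> i; apply/measurable_EFinP; apply: measurable_funM.
- by move=> i w _; rewrite lee_fin mulr_ge0.
rewrite -sumEFin; apply: eq_bigr => i _.
under eq_integral do rewrite EFinM.
rewrite ge0_integralZl_EFin//.
  by rewrite integral_indic// setIT EFinM fineK// fin_num_measure.
by apply/measurable_EFinP; exact: measurable_indic.
Qed.

(* For [N = \sum_i \1_(E i) / P (E i)] and [n = size s], integrate
   [2 N / n - N ^ 2 / n ^ 2 <= \1_(N > 0)]. *)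
Lemma second_moment (I : choiceType) (s : seq I) (E : I -> set T) :
  (0 < size s)%N -> (forall i, measurable (E i)) ->
  (forall i, i \in s -> 0 < fine (P (E i))) ->
  2 <= fine (P (\big[setU/set0]_(i <- s) E i)) +
    (size s)%:R ^- 2 * \sum_(i <- s) \sum_(j <- s)
      fine (P (E i `&` E j)) / (fine (P (E i)) * fine (P (E j))).
Proof.
move=> s0 mE E0; set U := \big[_/_]_(i <- s) _.
have mU : measurable U by exact: bigsetU_measurable.
set n : R := (size s)%:R; have n0 : 0 < n by rewrite ltr0n.
pose q i := (fine (P (E i)))^-1.
have q0 i : 0 <= q i by rewrite invr_ge0 fine_ge0.
pose st := [seq (i, j) | i <- s, j <- s].
have a0 i : 0 <= 2 / n * q i by rewrite mulr_ge0// divr_ge0// ltW.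
have c0 (ij : I * I) : 0 <= n ^- 2 * (q ij.1 * q ij.2).
  by rewrite mulr_ge0 ?invr_ge0 ?exprn_ge0 ?(ltW n0)// mulr_ge0.
have mEI (ij : I * I) : measurable (E ij.1 `&` E ij.2) by exact: measurableI.
have I1 := integral_indic_sum s a0 mE.
have I2 := integral_indic_sum st c0 mEI.
have -> : 2 = \sum_(i <- s) 2 / n * q i * fine (P (E i)).
  transitivity (\sum_(i <- s) 2 / n).
    by rewrite big_const_seq count_predT iter_addr_0 -[RHS]mulr_natr -/n divfK// gt_eqF.
  rewrite big_seq [RHS]big_seq; apply: eq_bigr => i si.
  by rewrite /q divfK// gt_eqF// E0.
have -> : n ^- 2 * (\sum_(i <- s) \sum_(j <- s)
      fine (P (E i `&` E j)) / (fine (P (E i)) * fine (P (E j)))) =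
    \sum_(ij <- st) n ^- 2 * (q ij.1 * q ij.2) * fine (P (E ij.1 `&` E ij.2)).
  rewrite big_allpairs mulr_sumr; apply: eq_bigr => i _.
  rewrite mulr_sumr; apply: eq_bigr => j _.
  by rewrite -mulrA /= /q -invfM; congr (_ * _); rewrite mulrC.
rewrite -lee_fin EFinD -I1 -I2 fineK ?fin_num_measure//.
rewrite -[X in (_ <= X + _)%E](_ : \int[P]_w (\1_U w)%:E = P U)%E; last first.
  by rewrite integral_indic// setIT.
rewrite -ge0_integralD//; last 3 first.
- by apply/measurable_EFinP; exact: measurable_indic.
- by move=> w _; rewrite lee_fin sumr_ge0// => ij _; rewrite mulr_ge0.
- by apply/measurable_EFinP; apply: measurable_sum => ij; apply: measurable_funM.
apply: ge0_le_integral => //.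
- by move=> w _; rewrite lee_fin sumr_ge0// => i _; rewrite mulr_ge0.
- by apply/measurable_EFinP; apply: measurable_sum => ij; apply: measurable_funM.
- apply: emeasurable_funD; first by apply/measurable_EFinP; exact: measurable_indic.
  by apply/measurable_EFinP; apply: measurable_sum => ij; apply: measurable_funM.
move=> w _; rewrite -EFinD lee_fin.
pose S := \sum_(i <- s) q i * \1_(E i) w.
have -> : \sum_(i <- s) 2 / n * q i * \1_(E i) w = 2 * (S / n).
  rewrite /S mulr_suml mulr_sumr; apply: eq_bigr => i _; ring.
have -> : \sum_(ij <- st) n ^- 2 * (q ij.1 * q ij.2) * \1_(E ij.1 `&` E ij.2) w = (S / n) ^+ 2.
  have SE : S / n = \sum_(i <- s) q i * \1_(E i) w / n by rewrite mulr_suml.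
  rewrite big_allpairs [RHS]expr2 {1}SE mulr_suml; apply: eq_bigr => i _.
  rewrite SE mulr_sumr; apply: eq_bigr => j _.
  by rewrite indicI /= -exprVn; ring.
have [wU|wU] := boolP (w \in U).
  have -> : \1_U w = 1 :> R by rewrite indicE wU.
  by move: (S / n) => x; have := sqr_ge0 (1 - x); rewrite expr2 => ?; nra.
have -> : S = 0.
  rewrite /S big_seq big1// => i si; rewrite indicE.
  have -> : w \in E i = false; last by rewrite mulr0.
  apply/negP => /set_mem Eiw; move/negP: wU; apply; apply/mem_set.
  have : (\bigcup_(j in [set` s]) E j) w by exists i.
  by rewrite bigcup_seq.
by rewrite mul0r mulr0 expr0n addr0.
Qed.

End SecondMoment.

(** * Probability that a block is crossed fast *)

Section BlockProbability.
Context {R : realType} {V : choiceType} (rho : V)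
  {d : measure_display} {Omega : measurableType d} (P : probability Omega R)
  (X : V -> {RV P >-> R}) (G : R -> R).
Hypothesis X_ge0 : forall v omega, 0 <= X v omega.
Hypothesis X_indep : independent_RVs P X.
Hypothesis X_cdf : common_cdf P X G.
Hypothesis X_laplace_fin : forall lam, 0 < lam ->
  ((laplace G lam)%:E =
   \int[@lebesgue_measure R]_x (exp_density x * G (x / lam))%:E)%E.

(* Tilting by [e ^ (- lam S)]: the mass outside [theta, tau] is bounded by
   comparing with the tilts [mu] and [nu]. *)
Lemma block_prob_lower (s : seq V) (lam mu nu theta tau : R) :
  uniq s -> 0 < mu -> mu <= lam -> lam <= nu ->
  expR (lam * theta) * (laplace G lam ^+ size s
    - expR (- ((lam - mu) * tau)) * laplace G mu ^+ size s
    - expR ((nu - lam) * theta) * laplace G nu ^+ size s)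
  <= fine (P [set w | \sum_(v <- s) X v w <= tau]).
Proof.
move=> us mu0 mulam lamnu.
pose S w := \sum_(v <- s) X v w.
have S0 w : 0 <= S w by apply: sumr_ge0.
have mS : measurable_fun setT S by apply: measurable_sum.
have mexp l : measurable_fun setT (fun w => expR (- (l * S w))).
  by apply: measurableT_comp => //; apply: measurable_funN; exact: measurable_funM.
have lapl l : 0 < l -> (\int[P]_w (expR (- (l * S w)))%:E = (laplace G l ^+ size s)%:E)%E.
  move=> l0; rewrite -[X in (_ ^+ X)%:E]card_ord -prodr_const.
  rewrite -(@laplace_path R V rho d Omega P X G X_ge0 X_indep X_cdf X_laplace_fin
    (size s) (fun=> l) s (fun=> l0) us (leqnn _)).
  by apply: eq_integral => w _; rewrite /S (big_nth rho) big_mkord -mulr_sumr.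
have lam0 : 0 < lam by exact: lt_le_trans mulam.
have nu0 : 0 < nu by exact: lt_le_trans lamnu.
set U := [set w | _]; have mU : measurable U by exact: measurable_le_set.
have H : (\int[P]_w (expR (- (lam * S w)))%:E <=
   \int[P]_w ((expR (- (lam * theta)))%:E * (\1_U w)%:E +
     ((expR (- ((lam - mu) * tau)))%:E * (expR (- (mu * S w)))%:E +
      (expR ((nu - lam) * theta))%:E * (expR (- (nu * S w)))%:E)))%E.
  apply: ge0_le_integral => //.
  - by apply/measurable_EFinP; exact: mexp.
  - apply: emeasurable_funD; last apply: emeasurable_funD.
    + by apply/measurable_EFinP; apply: measurable_funM => //; exact: measurable_indic.
    + by apply/measurable_EFinP; apply: measurable_funM => //; exact: mexp.
    + by apply/measurable_EFinP; apply: measurable_funM => //; exact: mexp.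
  move=> w _; rewrite -!EFinM -!EFinD lee_fin -!expRD.
  (* Pointwise, the [mu] term dominates when [S > tau], the indicator when [theta < S <= tau], and
     the [nu] term when [S <= theta]. *)
  have [Stau|tauS] := leP (S w) tau; last first.
    rewrite (@le_trans _ _ (expR (- ((lam - mu) * tau) - mu * S w)))//.
      rewrite ler_expR; have := ler_wpM2l (_ : 0 <= lam - mu) (ltW tauS).
      by rewrite subr_ge0 => /(_ mulam); lra.
    rewrite addrCA lerDl addr_ge0 ?expR_ge0// mulr_ge0 ?expR_ge0//.
  rewrite indicE mem_set// mulr1.
  have [Sth|thS] := leP (S w) theta; last first.
    rewrite (@le_trans _ _ (expR (- (lam * theta))))// ?ler_expR ?lerN2 ?ler_pM2l ?(ltW thS)//.
    by rewrite lerDl addr_ge0 ?expR_ge0.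
  rewrite (@le_trans _ _ (expR ((nu - lam) * theta - nu * S w)))//; last first.
    by rewrite addrA lerDr addr_ge0 ?expR_ge0.
  rewrite ler_expR; have := ler_wpM2l (_ : 0 <= nu - lam) Sth.
  by rewrite subr_ge0 => /(_ lamnu); lra.
move: H; rewrite lapl//.
have mexpE l : measurable_fun setT (fun w => (expR (- (l * S w)))%:E).
  by apply/measurable_EFinP; exact: mexp.
have mUE : measurable_fun setT (fun w => (\1_U w)%:E : \bar R).
  by apply/measurable_EFinP; exact: measurable_indic.
rewrite ge0_integralD//; last 3 first.
- by apply: emeasurable_funM.
- by move=> w _; rewrite adde_ge0// mule_ge0// lee_fin expR_ge0.
- by apply: emeasurable_funD; apply: emeasurable_funM.
rewrite ge0_integralD//; last 2 first.
- by apply: emeasurable_funM.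
- by apply: emeasurable_funM.
rewrite !ge0_integralZl_EFin ?expR_ge0//.
have -> : (\int[P]_w (\1_U w)%:E = (fine (P U))%:E)%E.
  by rewrite integral_indic// setIT fineK// fin_num_measure.
rewrite !lapl//.
rewrite -!EFinM -!EFinD lee_fin => H.
have : expR (lam * theta) * (laplace G lam ^+ size s) <= fine (P U) +
  expR (lam * theta) * (expR (- ((lam - mu) * tau)) * laplace G mu ^+ size s +
     expR ((nu - lam) * theta) * laplace G nu ^+ size s).
  apply: (le_trans (ler_wpM2l (expR_ge0 _) H)).
  by rewrite mulrDr mulrA -expRD subrr expR0 mul1r.
lra.
Qed.

End BlockProbability.

(** * Choice of the tilt and of the block length *)

Section BlockAsymptotics.
Context {R : realType}.
Variables (phi : R -> R) (alpha C u : R).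
Hypothesis alpha_gt0 : 0 < alpha.
Hypothesis C_gt0 : 0 < C.
Hypothesis u_gt1 : 1 < u.
Hypothesis phi_cvg : forall x : nat -> R, (forall n, 0 < x n) ->
  x n @[n --> \oo] --> +oo -> phi (x n) * x n `^ alpha @[n --> \oo] --> C.

Let u0 : 0 < u. Proof. exact: lt_trans u_gt1. Qed.

(* Tilting at rate [tilt_rate * y ^ (1 / alpha)] centres the passage time of a
   block of growth y at [tau / u] when
   [tau = (alpha * u / tilt_rate) * L * y ^ (- 1 / alpha)]. *)
Definition tilt_rate : R := expR 1 * C `^ alpha^-1 * u ^- 3.

Lemma tilt_rate_gt0 : 0 < tilt_rate.
Proof. by rewrite !mulr_gt0 ?expR_gt0 ?powR_gt0// invr_gt0 exprn_gt0. Qed.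

(** For large [L], [z1 ^+ L] exceeds 8 while each of the other powers is below a quarter of it. *)
Let limits_lt (z1 z2 z3 : R) : 1 < z1 -> 0 <= z2 < z1 -> 0 <= z3 < z1 ->
  exists2 L, (0 < L)%N & 2 < z1 ^+ L - z2 ^+ L - z3 ^+ L.
Proof.
move=> z11 /andP[z20 z21] /andP[z30 z31].
have z10 : 0 < z1 by exact: lt_trans z11.
have small (z : R) : 0 <= z < z1 -> \forall n \near \oo, (z / z1) ^+ n < 4^-1.
  move=> /andP[z0 zz]; have : (fun n => (z / z1) ^+ n) @ \oo --> (0 : R).
    apply: cvg_expr; rewrite ger0_norm; first by rewrite ltr_pdivrMr// mul1r.
    by rewrite divr_ge0// ltW.
  by move=> /cvgr_lt; apply; rewrite invr_gt0.
have big : \forall n \near \oo, (z1^-1) ^+ n < 8^-1.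
  have : (fun n => (z1^-1) ^+ n) @ \oo --> (0 : R).
    apply: cvg_expr; rewrite ger0_norm ?invr_ge0 ?(ltW z10)//.
    by rewrite invf_lt1.
  by move=> /cvgr_lt; apply; rewrite invr_gt0.
near \oo => L; exists L; first by near: L; exact: nbhs_infty_gt.
have h2 : (z2 / z1) ^+ L < 4^-1 by near: L; apply: small; rewrite z20.
have h3 : (z3 / z1) ^+ L < 4^-1 by near: L; apply: small; rewrite z30.
have h1 : (z1^-1) ^+ L < 8^-1 by near: L.
have zL : 0 < z1 ^+ L by rewrite exprn_gt0.
move: h1; rewrite exprVn ltf_pV2 ?posrE// => h1.
move: h2 h3; rewrite !expr_div_n !ltr_pdivrMr//; lra.
Unshelve. all: by end_near. Qed.

Let scaled_cvg (y : nat -> R) (a : R) : 0 < a -> (forall n, 0 < y n) ->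
  y n @[n --> \oo] --> +oo ->
  y n * phi (tilt_rate * y n `^ alpha^-1 * a) @[n --> \oo] -->
    C * (tilt_rate * a) `^ (- alpha).
Proof.
move=> a0 y0 yy; have K0 := tilt_rate_gt0.
have Ka : 0 < tilt_rate * a by rewrite mulr_gt0.
pose x n := tilt_rate * a * y n `^ alpha^-1.
have x0 n : 0 < x n by rewrite mulr_gt0// powR_gt0.
have xy : x n @[n --> \oo] --> +oo.
  apply/cvgryPge => M; pose m := Num.max (M / (tilt_rate * a)) 0.
  have m0 : 0 <= m by rewrite le_max lexx orbT.
  have := yy => /cvgryPge /(_ (m `^ alpha)); apply: filterS => n yn.
  rewrite /x mulrC -ler_pdivrMr//.
  apply: (@le_trans _ _ m); first by rewrite le_max lexx.
  rewrite -[leLHS]powRr1// -(divff (lt0r_neq0 alpha_gt0)) powRrM.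
  by rewrite ge0_ler_powR ?nnegrE ?invr_ge0 ?powR_ge0 ?(ltW alpha_gt0) ?(ltW (y0 n)).
rewrite (_ : (fun n => _) = (fun n => phi (x n) * x n `^ alpha * (tilt_rate * a) `^ (- alpha))).
  by apply: cvgM; [exact: phi_cvg|exact: cvg_cst].
apply/funext => n; rewrite -[tilt_rate * _ * a]mulrAC -/(x n) /x.
rewrite powRM ?powR_ge0 ?(ltW Ka)// -powRrM mulVf ?gt_eqF// powRr1 ?(ltW (y0 n))//.
by rewrite powRN; field; rewrite gt_eqF// powR_gt0.
Qed.

Let scaled_limit a : 0 < a ->
  C * (tilt_rate * a) `^ (- alpha) = expR (alpha * (3 * ln u - 1 - ln a)).
Proof.
move=> a0; rewrite powRN /tilt_rate.
rewrite -[C in LHS]lnK ?posrE// -{1}(lnK a0).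
rewrite /powR !gt_eqF ?mulr_gt0 ?expR_gt0 ?invr_gt0 ?exprn_gt0//.
rewrite expRK !lnM ?posrE ?mulr_gt0 ?expR_gt0 ?invr_gt0 ?exprn_gt0//.
rewrite !expRK lnV ?posrE ?exprn_gt0// lnXn// -expRN -expRD; congr expR.
rewrite -mulr_natr; field; rewrite gt_eqF//.
Qed.

(** The three terms tend to L-th powers of [z1], [z2], [z3], and the strict inequalities
    [1 - 1/u < ln u < u - 1] give [z1 > 1], [z2 < z1] and [z3 < z1]. For [z1] the exponent is
    controlled by [t^2 - 3 t + 2 = (1 - t) (2 - t) > 0] at [t = 1/u]. The length [L] is fixed before
    the sequence [y]. *)
Lemma block_asymptotics : exists2 L, (0 < L)%N & forall y : nat -> R,
  (forall n, 0 < y n) -> y n @[n --> \oo] --> +oo ->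
  \forall n \near \oo, let lam := tilt_rate * y n `^ alpha^-1 in
    2 <= y n ^+ L * (expR (alpha * L%:R * u ^- 2) *
      (phi lam ^+ L - expR (- (alpha * L%:R * (u - 1))) * phi (lam / u) ^+ L
       - expR (alpha * L%:R * ((u - 1) * u ^- 2)) * phi (lam * u) ^+ L)).
Proof.
pose t := u^-1.
have t0 : 0 < t by rewrite invr_gt0.
have t1 : t < 1 by rewrite invf_lt1.
have tu : u * t = 1 by rewrite mulfV// gt_eqF.
have lu : ln u < u - 1.
  have := @expR_gt1Dx _ (ln u); rewrite lnK ?posrE// gt_eqF ?ln_gt0// => /(_ isT); lra.
have lt : 1 - t < ln u.
  have := @expR_gt1Dx _ (- ln u); rewrite expRN lnK ?posrE// oppr_eq0 gt_eqF ?ln_gt0//.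
  by move=> /(_ isT); rewrite -/t; lra.
pose w1 := alpha * t ^+ 2.
pose w2 := alpha * t ^+ 2 - alpha * (u - 1).
pose w3 := alpha * t ^+ 2 + alpha * ((u - 1) * t ^+ 2).
pose z1 := expR (w1 + alpha * (3 * ln u - 1)).
pose z2 := expR (w2 + alpha * (3 * ln u - 1 + ln u)).
pose z3 := expR (w3 + alpha * (3 * ln u - 1 - ln u)).
have [|||L L0 HL] := @limits_lt z1 z2 z3.
- rewrite -expR0 ltr_expR /w1 -mulrDr mulr_gt0//.
  rewrite expr2; nra.
- rewrite expR_ge0 ltr_expR /w1 /w2 -subr_gt0.
  have -> : alpha * t ^+ 2 + alpha * (3 * ln u - 1) -
    (alpha * t ^+ 2 - alpha * (u - 1) + alpha * (3 * ln u - 1 + ln u)) = alpha * (u - 1 - ln u) by ring.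
  by rewrite mulr_gt0// subr_gt0.
- rewrite expR_ge0 ltr_expR /w1 /w3 -subr_gt0.
  have -> : alpha * t ^+ 2 + alpha * (3 * ln u - 1) -
    (alpha * t ^+ 2 + alpha * ((u - 1) * t ^+ 2) + alpha * (3 * ln u - 1 - ln u)) =
    alpha * (ln u - (u * t * t - t ^+ 2)) by ring.
  rewrite mulr_gt0// tu subr_gt0 (le_lt_trans _ lt)// mul1r; nra.
exists L => // y y0 yy.
have c1 := scaled_cvg ltr01 y0 yy; have c2 := scaled_cvg t0 y0 yy.
have c3 := scaled_cvg u0 y0 yy.
rewrite !scaled_limit// in c1 c2 c3.
have H : (fun n => (expR w1 * (y n * phi (tilt_rate * y n `^ alpha^-1 * 1))) ^+ L
    - (expR w2 * (y n * phi (tilt_rate * y n `^ alpha^-1 * t))) ^+ L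
    - (expR w3 * (y n * phi (tilt_rate * y n `^ alpha^-1 * u))) ^+ L) @ \oo
    --> z1 ^+ L - z2 ^+ L - z3 ^+ L.
  have cX (h : nat -> R) (l : R) : h @ \oo --> l -> (fun n => h n ^+ L) @ \oo --> l ^+ L.
    by move=> hl; exact: (cvg_comp h (fun x : R => x ^+ L) hl (@exprn_continuous _ L l)).
  apply: cvgB; first apply: cvgB; apply: cX.
  - rewrite /z1 (expRD w1); apply: cvgM; first exact: cvg_cst.
    by move: c1; rewrite ln1 subr0.
  - rewrite /z2 (expRD w2); apply: cvgM; first exact: cvg_cst.
    by move: c2; rewrite /t lnV ?posrE// opprK.
  - by rewrite /z3 (expRD w3); apply: cvgM => //; exact: cvg_cst.
apply: filterS (cvgr_gt _ H _ HL) => n /= /ltW h; apply: (le_trans h).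
rewrite mulr1 le_eqVlt; apply/orP; left; apply/eqP.
rewrite !exprMn -!expRM_natr /w1 /w2 /w3 /t exprVn.
have -> : (alpha * u ^- 2 - alpha * (u - 1)) * L%:R =
  alpha * L%:R * u ^- 2 - alpha * L%:R * (u - 1) by ring.
have -> : (alpha * u ^- 2 + alpha * ((u - 1) * u ^- 2)) * L%:R =
  alpha * L%:R * u ^- 2 + alpha * L%:R * ((u - 1) * u ^- 2) by ring.
have -> : alpha * u ^- 2 * L%:R = alpha * L%:R * u ^- 2 by ring.
by rewrite !expRD; ring.
Qed.

End BlockAsymptotics.

(** * Correlations between paths that meet the block constraints *)

Section BlockEvents.
Context {R : realType} {V : choiceType} (e : rel V) (rho : V) (f : nat -> nat)
  {d : measure_display} {Omega : measurableType d} (P : probability Omega R)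
  (X : V -> {RV P >-> R}) (G : R -> R).
Hypothesis tree_e : is_tree e.
Hypothesis sym_f : spherically_symmetric e rho f.
Hypothesis f_gt0 : forall n, (1 <= n)%N -> (1 <= f n)%N.
Hypothesis X_ge0 : forall v omega, 0 <= X v omega.
Hypothesis X_indep : independent_RVs P X.
Hypothesis X_cdf : common_cdf P X G.

Local Notation g := (tilde_growth R f).
Local Notation pr A := (fine (P A)).

Variables (L : nat) (tau : nat -> R) (b0 : nat) (C : R).
Hypothesis L_gt0 : (0 < L)%N.
Hypothesis C_ge1 : 1 <= C.
Local Notation y b := (g (b * L)).
Hypothesis block_prob : forall b s, (b0 <= b)%N -> uniq s -> size s = L ->
  2 <= y b ^+ L * pr [set w | \sum_(v <- s) X v w <= tau b].
Hypothesis tau_cdf : forall b, (b0 <= b)%N -> G (tau b) <= C / y b.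

(** Paths omit the root, so block [b] covers levels [b L + 1] to [(b + 1) L], where [g] is at least
    [y b]. *)
Definition path_block (p : seq V) b := take L (drop (b * L) p).

Definition block_event p b := [set w | \sum_(v <- path_block p b) X v w <= tau b].

Definition block_events p a c := \big[setI/setT]_(a <= b < c) block_event p b.

Let y_gt0 b : 0 < y b. Proof. exact: tilde_growth_gt0. Qed.

Lemma prob_indep s1 s2 (A1 A2 : set Omega) : uniq (s1 ++ s2) ->
  sub_event X s1 A1 -> sub_event X s2 A2 -> pr (A1 `&` A2) = pr A1 * pr A2.
Proof.
move=> us A1s A2s; rewrite (sub_event_indep X_indep us A1s A2s) fineM//.
  by rewrite fin_num_measure//; exact: sub_event_measurable A1s.
by rewrite fin_num_measure//; exact: sub_event_measurable A2s.
Qed.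

Let pr_ge0 A : 0 <= pr A. Proof. exact: fine_ge0. Qed.

Lemma sub_event_sum_le s q t : {subset q <= s} ->
  sub_event X s [set w | \sum_(v <- q) X v w <= t].
Proof.
move=> qs.
have E w : \sum_(v <- q) X v w = \sum_(j < size q) 1 * X (nth rho q j) w.
  by rewrite (big_nth rho) big_mkord; apply: eq_bigr => j _; rewrite mul1r.
have -> : [set w | \sum_(v <- q) X v w <= t] =
    [set w | \sum_(j < size q) 1 * X (nth rho q j) w <= t].
  by apply/seteqP; split => w /=; rewrite E.
apply: sub_event_le; apply: (@sub_measurable_sum R V rho d Omega P X s (size q) (fun=> 1) q) => //.
by rewrite take_size.
Qed.

Let mem_segment (p : seq V) a b c c' : (a <= b)%N -> (c' <= c)%N ->
  {subset drop b (take c' p) <= drop a (take c p)}.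
Proof.
move=> ab cc x; have [ac|ca] := leqP a c'; last first.
  by rewrite drop_oversize// size_take_min (leq_trans (geq_minl _ _))// (leq_trans (ltnW ca)).
rewrite -(subnK ab) -drop_drop => /mem_drop.
rewrite -(minn_idPl cc) take_min -{1}(subnK ac) -take_drop.
exact: mem_take.
Qed.

Let path_blockE p b : path_block p b = drop (b * L) (take (b.+1 * L) p).
Proof. by rewrite /path_block take_drop mulSn. Qed.

Lemma sub_block_events s p a c :
  {subset drop (a * L) (take (c * L) p) <= s} -> sub_event X s (block_events p a c).
Proof.
move=> ps; rewrite /block_events big_nat; apply: (@big_ind _ (sub_event X s)).
- exact: sub_eventT.
- by move=> A1 A2; exact: sub_eventI.
move=> b /andP[ab bc]; apply: sub_event_sum_le => v; rewrite path_blockE => vb.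
by apply: ps; apply: mem_segment vb; rewrite leq_mul2r ?ab ?bc orbT.
Qed.

Lemma measurable_block_events p a c : measurable (block_events p a c).
Proof.
apply: (@sub_event_measurable _ _ _ P _ X (drop (a * L) (take (c * L) p))).
exact: sub_block_events.
Qed.

Lemma block_events_cat p a b c : (a <= b)%N -> (b <= c)%N ->
  block_events p a c = block_events p a b `&` block_events p b c.
Proof. by move=> ab bc; rewrite /block_events (big_cat_nat ab bc). Qed.

Lemma block_events1 p b : block_events p b b.+1 = block_event p b.
Proof. by rewrite /block_events big_nat1. Qed.

Lemma prob_block_events_cat p a b c : uniq p -> (a <= b)%N -> (b <= c)%N ->
  pr (block_events p a c) = pr (block_events p a b) * pr (block_events p b c).
Proof.
move=> up ab bc; rewrite (block_events_cat p ab bc).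
apply: (@prob_indep (take (b * L) p) (drop (b * L) p)); first by rewrite cat_take_drop.
  by apply: sub_block_events => v /mem_drop.
apply: sub_block_events => v.
have bcL : (b * L <= c * L)%N by rewrite leq_mul2r bc orbT.
by rewrite -{1}(subnK bcL) -take_drop => /mem_take.
Qed.

(** Its inverse is the lower bound for the probability of all constraints from block [a] to block
    [c]; the halving records the slack in [block_prob]. *)
Definition block_weight a c := \prod_(a <= b < c) (y b ^+ L / 2).

Lemma block_weight_gt0 a c : 0 < block_weight a c.
Proof. by apply: prodr_gt0 => b _; rewrite divr_gt0// exprn_gt0. Qed.

Lemma block_event_prob_ge p b : uniq p -> (b0 <= b)%N -> (b.+1 * L <= size p)%N ->
  (y b ^+ L / 2)^-1 <= pr (block_event p b).
Proof.
move=> up b0b bp.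
have : size (path_block p b) = L.
  by rewrite size_takel// size_drop leq_subRL ?(leq_trans _ bp)// ?leq_mul2r ?leqnSn ?orbT// addnC -mulSn.
move=> /(block_prob b0b (take_uniq _ (drop_uniq _ up))) H.
by rewrite invf_div ler_pdivrMr ?exprn_gt0// mulrC.
Qed.

Lemma block_events_prob_ge p a c : uniq p -> (b0 <= a)%N -> (a <= c)%N -> (c * L <= size p)%N ->
  (block_weight a c)^-1 <= pr (block_events p a c).
Proof.
move=> up b0a /subnK <-; elim: (c - a)%N => [|k IHk] kp.
  rewrite add0n /block_weight /block_events !big_geq// invr1.
  by rewrite [P setT]probability_setT.
rewrite addSn (prob_block_events_cat (b := k + a) up) ?leq_addl// block_events1.
rewrite /block_weight big_nat_recr ?leq_addl//= -/(block_weight _ _) invfM.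
have b0k : (b0 <= k + a)%N by rewrite (leq_trans b0a)// leq_addl.
rewrite ler_pM ?invr_ge0 ?(ltW (block_weight_gt0 _ _))//.
- by rewrite divr_ge0// exprn_ge0// ltW.
- by apply: IHk; rewrite (leq_trans _ kp)// leq_mul2r leqnSn orbT.
- exact: block_event_prob_ge.
Qed.

Let uniq_catr (s t : seq V) : uniq (s ++ t) -> uniq t.
Proof. by rewrite cat_uniq => /and3P[]. Qed.

Let uniq_catl (s t : seq V) : uniq (s ++ t) -> uniq s.
Proof. by rewrite cat_uniq => /and3P[]. Qed.

Let pr_le A1 A2 : measurable A1 -> measurable A2 -> A1 `<=` A2 -> pr A1 <= pr A2.
Proof.
move=> m1 m2 A12; apply: fine_le; rewrite ?fin_num_measure//.
by apply: le_measure => //; exact: mem_set.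
Qed.

(** A relaxation of the constraints on a block: nonnegative times with sum at most [t] are each at
    most [t], and this event has an exact product probability. *)
Definition bounded_event (s : seq V) t := \big[setI/setT]_(v <- s) (X v @^-1` `]-oo, t]).

Lemma sub_bounded_event s t : sub_event X s (bounded_event s t).
Proof.
apply: sub_sigma_algebra; by exists (fun=> `]-oo, t]%classic).
Qed.

Lemma prob_bounded_event s t : uniq s -> pr (bounded_event s t) = G t ^+ size s.
Proof.
move=> us; rewrite /bounded_event (X_indep us (B := fun=> `]-oo, t]%classic))//.
elim: s {us} => [|v s IHs]; first by rewrite big_nil.
rewrite big_cons fineM.
- rewrite IHs exprS; congr (_ * _).
  by rewrite preimage_itvNyc (prob_RV_le X_cdf).
- by rewrite preimage_itvNyc (prob_RV_le X_cdf).
- under eq_bigr do rewrite preimage_itvNyc (prob_RV_le X_cdf).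
  by rewrite prodEFin.
Qed.

Definition pair_ratio p p' B :=
  pr (block_events p b0 B `&` block_events p' b0 B) /
  (pr (block_events p b0 B) * pr (block_events p' b0 B)).

(** For [k] common edges: the weight accounts for the whole blocks shared after [b0], the power of
    [y] for the shared part of the block where the paths separate. *)
Definition pair_bound k :=
  C ^+ (2 * L) * y (k %/ L) ^+ (k %% L) * block_weight b0 (k %/ L).

Lemma pair_bound_ge0 k : 0 <= pair_bound k.
Proof.
apply: mulr_ge0; last exact/ltW/block_weight_gt0.
by apply: mulr_ge0; apply: exprn_ge0; [exact: le_trans C_ge1|exact/ltW].
Qed.

(** Before the block [b] containing [k], only the constraints on [p] are kept; after it, those on
    the two paths are independent. Inside it, [2 L - i] distinct edges must have times at most
    [tau b], which has probability at most [(C / y b) ^ (2 L - i)]. Dividing by two block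
    probabilities of order [y b ^ - L] leaves [y b ^ i]. *)
Lemma pair_ratio_le B p p' k : p \in paths e rho (B * L) -> p' \in paths e rho (B * L) ->
  (b0 * L <= k)%N -> (k < B * L)%N ->
  take k.+1 p != take k.+1 p' -> pair_ratio p p' B <= pair_bound k.
Proof.
move=> pB pB' b0k kB pp'.
have up := paths_path_uniq tree_e sym_f pB; have up' := paths_path_uniq tree_e sym_f pB'.
have sp := size_paths_mem tree_e sym_f pB; have sp' := size_paths_mem tree_e sym_f pB'.
have U := paths_disjoint tree_e sym_f pB pB' pp'.
pose b := (k %/ L)%N; pose i := (k %% L)%N.
have kE : k = (b * L + i)%N by rewrite /b /i -divn_eq.
have iL : (i < L)%N by rewrite ltn_pmod.
have b0b : (b0 <= b)%N by rewrite leq_divRL.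
have bB : (b < B)%N by rewrite ltn_divLR.
have bLB : (b.+1 * L <= B * L)%N by rewrite leq_mul2r bB orbT.
(* The block of [p], followed by the part of the block of [p'] past the common prefix. *)
pose m := path_block p b ++ drop i (path_block p' b).
pose s3 := drop (b.+1 * L) p; pose s4 := drop (b.+1 * L) p'.
have dpE q : drop (b * L) q = path_block q b ++ drop (b.+1 * L) q.
  by rewrite /path_block -[LHS](cat_take_drop L) drop_drop mulSn addnC.
have sblk q : size q = (B * L)%N -> size (path_block q b) = L.
  by move=> sq; rewrite size_takel// size_drop sq leq_subRL ?(leq_trans _ bLB)// ?leq_mul2r ?leqnSn ?orbT// addnC -mulSn.
have dkE : drop k p' = drop i (path_block p' b) ++ s4.
  rewrite kE addnC -drop_drop dpE drop_cat sblk// iL//.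
have U1 : uniq (take (b * L) p ++ (drop (b * L) p ++ drop k p')).
  by rewrite catA cat_take_drop.
have U2 : uniq (m ++ (s3 ++ s4)).
  have <- : uniq (drop (b * L) p ++ drop k p') = uniq (m ++ (s3 ++ s4)).
    by apply: perm_uniq; rewrite dpE dkE /m -!catA perm_cat2l perm_catCA.
  exact: uniq_catr U1.
have U3 : uniq (s3 ++ s4) by exact: uniq_catr U2.
have um : uniq m by exact: uniq_catl U2.
pose a1 := block_events p b0 b; pose a1' := block_events p' b0 b.
pose c1 := block_events p b.+1 B; pose c1' := block_events p' b.+1 B.
have split3 q : uniq q -> pr (block_events q b0 B) =
    pr (block_events q b0 b) * (pr (block_event q b) * pr (block_events q b.+1 B)).
  move=> uq; rewrite (prob_block_events_cat uq b0b (ltnW bB)).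
  by rewrite (prob_block_events_cat uq (leqnSn b) bB) block_events1.
have num : pr (block_events p b0 B `&` block_events p' b0 B) <=
    pr a1 * (G (tau b) ^+ (2 * L - i) * (pr c1 * pr c1')).
  have sc1 : sub_event X s3 c1.
    apply: sub_block_events => v.
    by rewrite -(subnK bLB) -take_drop => /mem_take.
  have sc1' : sub_event X s4 c1'.
    apply: sub_block_events => v.
    by rewrite -(subnK bLB) -take_drop => /mem_take.
  have scc : sub_event X (s3 ++ s4) (c1 `&` c1').
    apply: sub_eventI; [apply: (sub_event_mono _ sc1)|apply: (sub_event_mono _ sc1')] => v vs;
    by rewrite mem_cat vs ?orbT.
  have sm : sub_event X m (bounded_event m (tau b)) by exact: sub_bounded_event.
  have smc : sub_event X (drop (b * L) p ++ drop k p') (bounded_event m (tau b) `&` (c1 `&` c1')).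
    have Hm : {subset m ++ (s3 ++ s4) <= drop (b * L) p ++ drop k p'}.
      move=> v; rewrite dpE dkE -/s3 !mem_cat => /orP[/orP[->//|->]|/orP[->|->]]; by rewrite ?orbT.
    by apply: sub_eventI; [apply: (sub_event_mono _ sm)|apply: (sub_event_mono _ scc)] => v vs;
      apply: Hm; rewrite mem_cat vs ?orbT.
  have sa1 : sub_event X (take (b * L) p) a1 by apply: sub_block_events => v /mem_drop.
  have -> : G (tau b) ^+ (2 * L - i) = pr (bounded_event m (tau b)).
    rewrite prob_bounded_event// /m size_cat size_drop !sblk//; congr (_ ^+ _); lia.
  rewrite -(prob_indep U3)// -(prob_indep U2)// -(prob_indep U1)//.
  apply: pr_le.
  - by apply: measurableI; exact: measurable_block_events.
  - apply: measurableI; first exact: sub_event_measurable sa1.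
    exact: sub_event_measurable smc.
  rewrite (block_events_cat p b0b (ltnW bB)) (block_events_cat p (leqnSn b) bB).
  rewrite (block_events_cat p' b0b (ltnW bB)) (block_events_cat p' (leqnSn b) bB).
  rewrite !block_events1 => w [[wa1 [wb wc1]] [wa1' [wb' wc1']]].
  split=> //; split=> //; rewrite /bounded_event -bigcap_seq => v /=.
  rewrite in_itv/= mem_cat => /orP[vb|/mem_drop vb].
    apply: le_trans wb; rewrite (big_rem v)//= lerDl; exact: sumr_ge0.
  apply: le_trans wb'; rewrite (big_rem v)//= lerDl; exact: sumr_ge0.
have q0 : (y b ^+ L / 2)^-1 <= pr (block_event p b).
  by apply: block_event_prob_ge; rewrite ?sp.
have q0' : (y b ^+ L / 2)^-1 <= pr (block_event p' b).
  by apply: block_event_prob_ge; rewrite ?sp'.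
have a0' : (block_weight b0 b)^-1 <= pr a1'.
  by apply: block_events_prob_ge; rewrite ?sp' ?leq_mul2r ?(ltnW bB) ?orbT.
have Wpos a c : 0 < (block_weight a c)^-1 by rewrite invr_gt0 block_weight_gt0.
have a1_gt0 : 0 < pr a1.
  apply: lt_le_trans (Wpos b0 b) _; apply: block_events_prob_ge => //.
  by rewrite sp leq_mul2r (ltnW bB) orbT.
have c1_gt0 : 0 < pr c1.
  apply: lt_le_trans (Wpos b.+1 B) _; apply: block_events_prob_ge => //; last by rewrite sp.
  exact: leq_trans (leqnSn _).
have c1'_gt0 : 0 < pr c1'.
  apply: lt_le_trans (Wpos b.+1 B) _; apply: block_events_prob_ge => //; last by rewrite sp'.
  exact: leq_trans (leqnSn _).
have yL : 0 < (y b ^+ L / 2)^-1 by rewrite invr_gt0 divr_gt0// exprn_gt0.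
have qp : 0 < pr (block_event p b) by exact: lt_le_trans q0.
have qp' : 0 < pr (block_event p' b) by exact: lt_le_trans q0'.
have a1'_gt0 : 0 < pr a1' by exact: lt_le_trans a0'.
have Gp : 0 <= G (tau b) by exact: (common_cdf_ge0 rho X_cdf).
apply: (@le_trans _ _ (G (tau b) ^+ (2 * L - i) *
    ((pr (block_event p b))^-1 * ((pr a1')^-1 * (pr (block_event p' b))^-1)))).
  rewrite /pair_ratio (split3 p)// (split3 p')// ler_pdivrMr ?mulr_gt0//.
  apply: (le_trans num); rewrite le_eqVlt; apply/orP; left; apply/eqP.
  rewrite -/a1 -/a1' -/c1 -/c1'; field.
  by rewrite !gt_eqF.
apply: (@le_trans _ _ ((C / y b) ^+ (2 * L - i) *
    ((y b ^+ L / 2) * (block_weight b0 b * (y b ^+ L / 2))))).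
  have inv_le (x z : R) : 0 < x -> 0 < z -> x^-1 <= z -> z^-1 <= x.
    by move=> x0 z0 xz; rewrite -[leRHS]invrK lef_pV2// posrE invr_gt0.
  have y2 : 0 < y b ^+ L / 2 by rewrite -invr_gt0.
  apply: ler_pM; rewrite ?exprn_ge0 ?mulr_ge0 ?invr_ge0//.
    apply: lerXn2r; rewrite ?nnegrE//; last exact: tau_cdf.
    by rewrite divr_ge0 ?(ltW (y_gt0 _))// (le_trans ler01).
  apply: ler_pM; rewrite ?mulr_ge0 ?invr_ge0//; first exact: inv_le.
  apply: ler_pM; rewrite ?invr_ge0//; last exact: inv_le.
  by apply: inv_le => //; exact: block_weight_gt0.
rewrite /pair_bound -/b -/i.
have -> : (C / y b) ^+ (2 * L - i) * ((y b ^+ L / 2) * (block_weight b0 b * (y b ^+ L / 2))) =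
   4^-1 * (C ^+ (2 * L - i) * y b ^+ i * block_weight b0 b).
  have yE : y b ^+ L * y b ^+ L = y b ^+ (2 * L - i) * y b ^+ i.
    have iE : (2 * L - i + i = L + L)%N by clear -iL; lia.
    by rewrite -exprD -exprD iE.
  have yn : y b ^+ (2 * L - i) != 0 by rewrite expf_neq0// gt_eqF.
  rewrite expr_div_n; apply: (mulfI yn); move: yE yn.
  move: (y b ^+ L) (y b ^+ (2 * L - i)) (y b ^+ i) => A1 A2 A3 yE yn.
  transitivity (4^-1 * C ^+ (2 * L - i) * block_weight b0 b * (A1 * A1)).
    by field.
  by rewrite yE; ring.
have Cp : C ^+ (2 * L - i) <= C ^+ (2 * L) by rewrite ler_weXn2l// leq_subr.
have Cp0 : 0 <= C ^+ (2 * L - i) by rewrite exprn_ge0// (le_trans ler01).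
have yW : 0 <= y b ^+ i * block_weight b0 b.
  by rewrite mulr_ge0 ?exprn_ge0 ?(ltW (block_weight_gt0 _ _)) ?(ltW (y_gt0 _)).
rewrite -!mulrA; apply: (@le_trans _ _ (C ^+ (2 * L - i) * (y b ^+ i * block_weight b0 b))).
  by apply: ler_piMl; [exact: mulr_ge0|rewrite invf_le1// ler1n].
by rewrite ler_wpM2r.
Qed.

Lemma pair_ratio_le1 B p p' k : p \in paths e rho (B * L) -> p' \in paths e rho (B * L) ->
  (b0 <= B)%N -> (k <= b0 * L)%N -> take k.+1 p != take k.+1 p' -> pair_ratio p p' B <= 1.
Proof.
move=> pB pB' b0B kb0 pp'.
have U := paths_disjoint tree_e sym_f pB pB' pp'.
have U' : uniq (p ++ drop (b0 * L) p').
  apply: subseq_uniq U; apply: cat_subseq; first exact: subseq_refl.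
  by rewrite -(subnK kb0) -drop_drop; exact: drop_subseq.
rewrite /pair_ratio (prob_indep U'); last 2 first.
- by apply: sub_block_events => v /mem_drop /mem_take.
- apply: sub_block_events => v.
  by rewrite -(subnK (_ : b0 * L <= B * L)%N) ?leq_mul2r ?b0B ?orbT// -take_drop => /mem_take.
(* Independent events have ratio 1, or 0 when the denominator vanishes, as [0 / 0 = 0]. *)
set x := pr (block_events p b0 B) * pr (block_events p' b0 B); have [->|x0] := eqVneq x 0; first by rewrite mul0r ler01.
by rewrite divff.
Qed.

Lemma pair_ratio_diag B p : p \in paths e rho (B * L) -> (b0 <= B)%N ->
  pair_ratio p p B <= pair_bound (B * L).
Proof.
move=> pB b0B; have up := paths_path_uniq tree_e sym_f pB.
have sp := size_paths_mem tree_e sym_f pB.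
have H : (block_weight b0 B)^-1 <= pr (block_events p b0 B).
  by apply: block_events_prob_ge; rewrite ?sp.
have H0 : 0 < (block_weight b0 B)^-1 by rewrite invr_gt0 block_weight_gt0.
have Hp : 0 < pr (block_events p b0 B) by exact: lt_le_trans H.
rewrite /pair_ratio setIid invfM mulrA divff ?gt_eqF// mul1r.
rewrite /pair_bound modnMl mulnK// expr0 mulr1.
apply: (@le_trans _ _ (block_weight b0 B)).
  by rewrite -[leRHS]invrK lef_pV2// posrE.
by rewrite ler_peMl ?exprn_ege1// ltW// block_weight_gt0.
Qed.

(** Only the term at the length of the common prefix matters. Summing over all [k] below that length
    yields prefix indicators, which [count_extensions] can then sum over [p']. *)
Lemma pair_ratio_le_sum B p p' : (b0 <= B)%N ->
  p \in paths e rho (B * L) -> p' \in paths e rho (B * L) ->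
  pair_ratio p p' B <=
    1 + \sum_(b0 * L <= k < (B * L).+1) (take k p' == take k p)%:R * pair_bound k.
Proof.
move=> b0B pB pB'; have sp := size_paths_mem tree_e sym_f pB.
have sp' := size_paths_mem tree_e sym_f pB'.
have b0BL : (b0 * L <= B * L)%N by rewrite leq_mul2r b0B orbT.
have term k : (b0 * L <= k)%N -> (k <= B * L)%N -> take k p' = take k p ->
    pair_bound k <= \sum_(b0 * L <= k < (B * L).+1) (take k p' == take k p)%:R * pair_bound k.
  move=> b0k kB pk; rewrite (bigD1_seq k) ?mem_index_iota ?b0k ?ltnS ?iota_uniq//=.
  rewrite pk eqxx mul1r lerDl; apply: sumr_ge0 => j _.
  by rewrite mulr_ge0 ?pair_bound_ge0.
have [E|pp'] := eqVneq p p'.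
  subst p'.
  apply: (le_trans (pair_ratio_diag pB b0B)).
  have h := term (B * L)%N b0BL (leqnn _) erefl; apply: (le_trans h).
  by rewrite lerDr ler01.
have [k /andP[kn kne] kmin] : exists2 k, (k < B * L)%N && (take k.+1 p != take k.+1 p') &
    forall j, (j < B * L)%N && (take j.+1 p != take j.+1 p') -> (k <= j)%N.
  have ex : exists k, (k < B * L)%N && (take k.+1 p != take k.+1 p').
    have BL0 : (0 < B * L)%N.
      rewrite lt0n; apply: contraNneq pp' => BL0.
      by rewrite (size0nil (etrans sp BL0)) (size0nil (etrans sp' BL0)).
    exists (B * L).-1; rewrite prednK// leqnn/=.
    by rewrite -{1}sp -sp' !take_size.
  by case: (ex_minnP ex) => k h hm; exists k.
have keq : take k p = take k p'.
  case: k kn kne kmin => [|k] kn kne kmin; first by rewrite !take0.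
  apply/eqP/negP => /negP h; have := kmin k; rewrite h (ltnW kn) => /(_ isT).
  by rewrite ltnn.
have [kb0|b0k] := leqP k (b0 * L).
  apply: (le_trans (pair_ratio_le1 pB pB' b0B kb0 kne)); rewrite lerDl.
  by apply: sumr_ge0 => j _; rewrite mulr_ge0 ?pair_bound_ge0.
apply: (le_trans (pair_ratio_le pB pB' (ltnW b0k) kn kne)).
by apply: (le_trans (term _ (ltnW b0k) (ltnW kn) (esym keq))); rewrite lerDr.
Qed.

End BlockEvents.

(** * Second moment over all paths and survival through every block *)

Section UpperBound.
Context {R : realType} {V : choiceType} (e : rel V) (rho : V) (f : nat -> nat)
  {d : measure_display} {Omega : measurableType d} (P : probability Omega R)
  (X : V -> {RV P >-> R}) (G : R -> R) (alpha : R).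
Hypothesis tree_e : is_tree e.
Hypothesis sym_f : spherically_symmetric e rho f.
Hypothesis f_gt0 : forall n, (1 <= n)%N -> (1 <= f n)%N.
Hypothesis X_ge0 : forall v omega, 0 <= X v omega.
Hypothesis X_indep : independent_RVs P X.
Hypothesis X_cdf : common_cdf P X G.
Hypothesis alpha_gt0 : 0 < alpha.

Local Notation g := (tilde_growth R f).
Local Notation pr A := (fine (P A)).
Local Notation path_time p w := (\sum_(v <- p) X v w).
Local Notation min_time := (min_passage_time e rho X).
Local Notation sigma := (power_sum alpha g).

Variables (L : nat) (tau : nat -> R) (b1 : nat) (C A : R).
Hypothesis L_gt0 : (0 < L)%N.
Hypothesis C_ge1 : 1 <= C.
Hypothesis A_ge0 : 0 <= A.
Local Notation y b := (g (b * L)).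
Hypothesis block_prob : forall b s, (b1 <= b)%N -> uniq s -> size s = L ->
  2 <= y b ^+ L * pr [set w | \sum_(v <- s) X v w <= tau b].
Hypothesis tau_cdf : forall b, (b1 <= b)%N -> G (tau b) <= C / y b.
Hypothesis tau_le : forall b, (b1 <= b)%N -> tau b <= A * (L%:R * y b `^ (- alpha^-1)).

Local Notation block_events := (block_events X L tau).

Let y_gt0 b : 0 < y b. Proof. exact: tilde_growth_gt0. Qed.

Lemma tilde_prod_growth m i : tilde_prod R f m * g m ^+ i <= tilde_prod R f (m + i).
Proof.
elim: i => [|i IHi]; first by rewrite expr0 mulr1 addn0.
rewrite addnS tilde_prodS exprSr mulrA ler_pM ?mulr_ge0 ?exprn_ge0//.
- by rewrite ltW// tilde_prod_gt0.
- by rewrite ltW// tilde_growth_gt0.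
- by rewrite ltW// tilde_growth_gt0.
- by apply: tilde_growth_mono => //; rewrite leqW// leq_addr.
Qed.

Section FromBlock.
Variable b0 : nat.
Hypothesis b10 : (b1 <= b0)%N.
Hypothesis b0_gt0 : (0 < b0)%N.

(** Across a block [p] gains at least [y ^ L] and the weight only [y ^ L / 2]: hence the factor 2
    per block. *)
Let weight_tilde_prod b : (b0 <= b)%N ->
  tilde_prod R f (b0 * L) * 2 ^+ (b - b0) * @block_weight R f L b0 b <= tilde_prod R f (b * L).
Proof.
move=> /subnK <-; elim: (b - b0)%N => [|k IHk].
  by rewrite add0n subnn expr0 mulr1 /block_weight big_geq// mulr1.
rewrite addnK in IHk; rewrite addnK addSn.
rewrite /block_weight big_nat_recr ?leq_addl//= -/(@block_weight R f L b0 (k + b0)).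
have := tilde_prod_growth ((k + b0) * L) L.
rewrite [(_ * L + L)%N]addnC -mulSn; apply: le_trans.
rewrite exprSr.
rewrite (_ : _ * _ = (tilde_prod R f (b0 * L) * 2 ^+ k * @block_weight R f L b0 (k + b0)) * y (k + b0) ^+ L); last by field.
by rewrite ler_wpM2r// exprn_ge0// ltW.
Qed.

Let pair_bound_size k : (b0 * L <= k)%N ->
  pair_bound f L b0 C k / (level_size f k)%:R <=
  C ^+ (2 * L) / tilde_prod R f (b0 * L) * 2^-1 ^+ (k %/ L - b0).
Proof.
move=> b0k; have F0 : 0 < (level_size f k)%:R :> R by rewrite ltr0n level_size_gt0.
have p0 := tilde_prod_gt0 R f_gt0 (b0 * L).
have b0b : (b0 <= k %/ L)%N by rewrite leq_divRL.
rewrite ler_pdivrMr// exprVn.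
rewrite (_ : C ^+ (2 * L) / _ / _ * _ = (C ^+ (2 * L) * (level_size f k)%:R) / (tilde_prod R f (b0 * L) * 2 ^+ (k %/ L - b0))); last first.
  by field; rewrite !gt_eqF// exprn_gt0.
have d0 : 0 < tilde_prod R f (b0 * L) * 2 ^+ (k %/ L - b0) by rewrite mulr_gt0// exprn_gt0.
rewrite ler_pdivlMr// /pair_bound -!mulrA ler_wpM2l ?exprn_ge0 ?(le_trans ler01)//.
apply: le_trans (tilde_prod_le R f_gt0 k).
have := tilde_prod_growth (k %/ L * L) (k %% L); rewrite -divn_eq; apply: le_trans.
have := weight_tilde_prod b0b => /(ler_wpM2r (exprn_ge0 (k %% L) (ltW (y_gt0 (k %/ L))))).
apply: le_trans; rewrite le_eqVlt; apply/orP; left; apply/eqP; ring.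
Qed.

Let geometric_block_sum m :
  \sum_(b0 * L <= k < (m + b0) * L) (2^-1 : R) ^+ (k %/ L - b0) =
  L%:R * (2 - 2 * 2^-1 ^+ m).
Proof.
elim: m => [|m IHm]; first by rewrite add0n big_geq// expr0; ring.
rewrite (big_cat_nat (n := (m + b0) * L)) ?leq_mul2r ?leq_addl ?addSn ?leqnSn ?orbT//= IHm.
rewrite (eq_big_nat _ _ (F2 := fun=> 2^-1 ^+ m)); last first.
  move=> k /andP[h1 h2]; congr (_ ^+ _).
  have -> : (k %/ L = m + b0)%N; last by rewrite addnK.
  by apply/eqP; rewrite eqn_leq leq_divRL// h1 andbT -ltnS ltn_divLR.
by rewrite sumr_const_nat -mulnBl subSnn mul1n exprS -mulr_natl; field.
Qed.

Let event_union B := \big[setU/set0]_(p <- paths e rho (B * L)) block_events p b0 B.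

Let measurable_event_union B : measurable (event_union B).
Proof.
apply: bigsetU_measurable => p _; exact: (@measurable_block_events R V rho d Omega P X L tau p b0 B).
Qed.

Let block_prob0 b s : (b0 <= b)%N -> uniq s -> size s = L ->
  2 <= y b ^+ L * pr [set w | \sum_(v <- s) X v w <= tau b].
Proof. by move=> b0b; apply: block_prob; exact: leq_trans b0b. Qed.

Let tau_cdf0 b : (b0 <= b)%N -> G (tau b) <= C / y b.
Proof. by move=> b0b; apply: tau_cdf; exact: leq_trans b0b. Qed.

Lemma block_union_prob B : (b0 <= B)%N ->
  1 - 2 * L%:R * (C ^+ (2 * L) / tilde_prod R f (b0 * L)) <= pr (event_union B).
Proof.
move=> b0B; set s := paths e rho (B * L).
have ss : size s = level_size f (B * L) by rewrite (size_paths tree_e sym_f).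
have s0 : (0 < size s)%N by rewrite ss level_size_gt0.
have := @second_moment _ _ _ P _ s (fun p => block_events p b0 B) s0.
move=> /(_ (fun p => @measurable_block_events R V rho d Omega P X L tau p b0 B)).
have prp p : p \in s -> 0 < pr (block_events p b0 B).
  move=> ps; have up := paths_path_uniq tree_e sym_f ps.
  have := @block_events_prob_ge R V rho f d Omega P X f_gt0 X_indep L tau b0 block_prob0 p b0 B up.
  rewrite leqnn b0B (size_paths_mem tree_e sym_f ps) leqnn => /(_ isT isT isT).
  by apply: lt_le_trans; rewrite invr_gt0 block_weight_gt0.
move=> /(_ prp) H.
set N : R := (size s)%:R in H; have N0 : 0 < N by rewrite ltr0n.
have ratio_sum : \sum_(p <- s) \sum_(p' <- s)
    pr (block_events p b0 B `&` block_events p' b0 B) /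
    (pr (block_events p b0 B) * pr (block_events p' b0 B)) <=
    N ^+ 2 * (1 + \sum_(b0 * L <= k < (B * L).+1) pair_bound f L b0 C k / (level_size f k)%:R).
  apply: (@le_trans _ _ (\sum_(p <- s) \sum_(p' <- s)
      (1 + \sum_(b0 * L <= k < (B * L).+1) (take k p' == take k p)%:R * pair_bound f L b0 C k))).
    rewrite big_seq [leRHS]big_seq; apply: ler_sum => p ps.
    rewrite big_seq [leRHS]big_seq; apply: ler_sum => p' p's.
    exact: (pair_ratio_le_sum tree_e sym_f f_gt0 X_ge0 X_indep X_cdf L_gt0 C_ge1 block_prob0 tau_cdf0 b0B ps p's).
  apply: (@le_trans _ _ (\sum_(p <- s) N *
      (1 + \sum_(b0 * L <= k < (B * L).+1) pair_bound f L b0 C k / (level_size f k)%:R))).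
    rewrite big_seq [leRHS]big_seq; apply: ler_sum => p ps.
    rewrite big_split/= big_const_seq count_predT iter_addr_0 -/N mulrDr mulr1 lerD2l.
    (* For fixed [k], the number of [p'] sharing a prefix of length [k] with [p] is [N / F_k]. *)
    rewrite exchange_big/= mulr_sumr big_nat [leRHS]big_nat; apply: ler_sum => k /andP[b0k kB].
    rewrite -mulr_suml [leRHS]mulrCA [leRHS]mulrC ler_wpM2r//.
      exact: pair_bound_ge0.
    have kB' : (k <= B * L)%N by [].
    have := count_extensions tree_e sym_f kB' (take_paths tree_e sym_f kB' ps).
    rewrite -ss => /(congr1 (fun n => n%:R : R)); rewrite natrM => cE.
    rewrite ler_pdivlMr ?ltr0n ?level_size_gt0// /N -cE ler_wpM2r//.
    rewrite -sum1_count natr_sum -/s [leRHS]big_mkcond/=.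
    by apply: ler_sum => p' _; case: eqP.
  by rewrite big_const_seq count_predT iter_addr_0 -mulr_natr -/N expr2 mulrAC.
have {ratio_sum} := le_trans H (lerD (lexx _) (ler_wpM2l (_ : 0 <= N ^- 2) ratio_sum)).
rewrite invr_ge0 exprn_ge0 ?(ltW N0)// => /(_ isT).
rewrite mulKf ?expf_neq0 ?gt_eqF// => {}H.
have bound_sum : \sum_(b0 * L <= k < (B * L).+1) pair_bound f L b0 C k / (level_size f k)%:R <=
    2 * L%:R * (C ^+ (2 * L) / tilde_prod R f (b0 * L)).
  have D0 : 0 <= C ^+ (2 * L) / tilde_prod R f (b0 * L).
    apply: divr_ge0; last exact/ltW/tilde_prod_gt0.
    by apply: exprn_ge0; exact: le_trans C_ge1.
  apply: (@le_trans _ _ (\sum_(b0 * L <= k < (B.+1 - b0 + b0) * L)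
      C ^+ (2 * L) / tilde_prod R f (b0 * L) * 2^-1 ^+ (k %/ L - b0))).
    rewrite subnK ?leqW//.
    have h1 : (b0 * L <= (B * L).+1)%N by rewrite leqW// leq_mul2r b0B orbT.
    have h2 : ((B * L).+1 <= B.+1 * L)%N by rewrite mulSn -add1n leq_add2r.
    rewrite [leRHS](big_cat_nat h1 h2)/=.
    rewrite ler_wpDr//; first by apply: sumr_ge0 => k _; rewrite mulr_ge0 ?exprn_ge0.
    by rewrite big_nat [leRHS]big_nat; apply: ler_sum => k /andP[b0k _]; exact: pair_bound_size.
  rewrite -mulr_sumr geometric_block_sum mulrC ler_wpM2r// [leRHS]mulrC ler_wpM2l//.
  by rewrite gerBl mulr_ge0 ?exprn_ge0.
rewrite /event_union; lra.
Qed.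

Let event_union_decr m n : (m <= n)%N -> (b0 <= m)%N -> event_union n `<=` event_union m.
Proof.
move=> mn b0m w; rewrite /event_union -!bigcup_seq => -[p /= pn].
rewrite (block_events_cat X L tau p b0m mn) => -[wm _].
have mnL : (m * L <= n * L)%N by rewrite leq_mul2r mn orbT.
exists (take (m * L) p) => /=; first exact: (take_paths tree_e sym_f mnL pn).
move: wm; rewrite /block_events -!bigcap_seq => wm b /= bm; have := wm b bm.
have /andP[_ {}bm] : (b0 <= b < m)%N by rewrite -mem_index_iota.
rewrite /block_event /= /path_block; congr (_ <= _); congr bigop.
rewrite !take_drop take_takel// -mulSn leq_mul2r bm orbT//.
Qed.

(** The path meeting the constraints may depend on the level reached, since [min_time] is bounded
    level by level. *)
Definition surviving_event := \bigcap_m event_union (m + b0).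

Lemma measurable_surviving_event : measurable surviving_event.
Proof. by apply: bigcap_measurable => // m _; exact: measurable_event_union. Qed.

Lemma surviving_event_prob :
  ((1 - 2 * L%:R * (C ^+ (2 * L) / tilde_prod R f (b0 * L)))%:E <= P surviving_event)%E.
Proof.
have H : P (event_union (m + b0)) @[m --> \oo] --> P surviving_event.
  apply: (nonincreasing_cvg_mu (F := fun m => event_union (m + b0))).
  - by rewrite (le_lt_trans (probability_le1 _ _)) ?ltry//; exact: measurable_event_union.
  - by move=> m; exact: measurable_event_union.
  - exact: measurable_surviving_event.
  - by move=> m n mn; apply/subsetPset; apply: event_union_decr; rewrite ?leq_add2r ?leq_addl.
apply: cvge_ge H.
apply: nearW => m; rewrite -[leRHS]fineK; last by rewrite fin_num_measure//; exact: measurable_event_union.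
by rewrite lee_fin; apply: block_union_prob; rewrite leq_addl.
Qed.

(** As [g] is nondecreasing, the term of a block is at most the sum of the terms of [sigma] over the
    preceding block; hence [B.-1], and the need for [b0 > 0]. *)
Let block_sum B : (b0 <= B)%N ->
  \sum_(b0 <= b < B) L%:R * y b `^ (- alpha^-1) <= sigma (B.-1 * L).
Proof.
move=> /subnK <-; elim: (B - b0)%N => [|k IHk].
  by rewrite add0n big_geq// power_sumE sumr_ge0// => j _; exact: powR_ge0.
rewrite addSn big_nat_recr ?leq_addl//= (le_trans (lerD IHk (lexx _)))//.
have E : ((k + b0) * L = (k + b0).-1 * L + L)%N.
  have kb0 : (0 < k + b0)%N by rewrite addn_gt0 b0_gt0 orbT.
  by rewrite -{1}(prednK kb0) mulSn addnC.
rewrite {2}E !power_sumE big_split_ord/= lerD2l.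
have -> : L%:R * y (k + b0) `^ (- alpha^-1) = \sum_(i < L) y (k + b0) `^ (- alpha^-1).
  by rewrite sumr_const card_ord mulr_natl.
apply: ler_sum => i _; rewrite -[X in _ <= X `^ _]/(g ((k + b0).-1 * L + i).+1).
rewrite !powRN lef_pV2 ?posrE ?powR_gt0 ?tilde_growth_gt0//.
apply: ge0_ler_powR; rewrite ?invr_ge0 ?nnegrE ?(ltW alpha_gt0) ?(ltW (tilde_growth_gt0 _ _ _))//.
by apply: tilde_growth_mono => //; rewrite E -addnS leq_add2l.
Qed.

Lemma surviving_min_time w : surviving_event w ->
  exists K0, forall n, min_time n w <= K0 + A * sigma n.
Proof.
(* The unconstrained part up to level [b0 L] depends on the path; the sum over all such paths bounds
   it uniformly. *)
move=> sw; exists (\sum_(p <- paths e rho (b0 * L)) path_time p w) => n.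
(* The maximum of [b0] and the number of blocks needed to pass level [n]. *)
pose B := ((n %/ L).+1 - b0 + b0)%N.
have b0B : (b0 <= B)%N by rewrite leq_addl.
have nB : (n <= B * L)%N.
  rewrite (leq_trans (ltnW (ltn_ceil n L_gt0)))// leq_mul2r /B; apply/orP; right; lia.
have := sw ((n %/ L).+1 - b0)%N I; rewrite /event_union -bigcup_seq => -[p /= pB pw].
have pos q : 0 <= path_time q w by exact: sumr_ge0.
have take_le q k : path_time (take k q) w <= path_time q w.
  by rewrite -[in leRHS](cat_take_drop k q) big_cat/= lerDl.
have sigma0 k : 0 <= sigma k by rewrite power_sumE sumr_ge0// => j _; exact: powR_ge0.
have b0BL : (b0 * L <= B * L)%N by rewrite leq_mul2r b0B orbT.
have p0 : path_time (take (b0 * L) p) w <= \sum_(p <- paths e rho (b0 * L)) path_time p w.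
  rewrite (big_rem (take (b0 * L) p)) ?(take_paths tree_e sym_f b0BL pB)//= lerDl.
  exact: sumr_ge0.
have h := min_time_le tree_e sym_f X_ge0 w (take_paths tree_e sym_f nB pB).
apply: (le_trans h).
have [nb0|b0n] := leqP n (b0 * L).
  apply: (@le_trans _ _ (path_time (take (b0 * L) p) w)).
    by rewrite -(take_takel p nb0).
  by apply: (le_trans p0); rewrite lerDl mulr_ge0.
have BE : B = (n %/ L).+1.
  by rewrite /B subnK// leqW// leq_divRL// ltnW.
apply: (le_trans (take_le p n)).
have decomp c : (b0 <= c)%N -> path_time (take (c * L) p) w =
    path_time (take (b0 * L) p) w + \sum_(b0 <= b < c) path_time (path_block L p b) w.
  move=> /subnK <-; elim: (c - b0)%N => [|k IHk]; first by rewrite add0n big_geq// addr0.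
  rewrite addSn big_nat_recr ?leq_addl//= addrA -IHk mulSn.
  by rewrite [(L + _)%N]addnC takeD big_cat.
have -> : path_time p w = path_time (take (B * L) p) w.
  by rewrite -(size_paths_mem tree_e sym_f pB) take_size.
rewrite decomp// lerD//.
apply: (@le_trans _ _ (\sum_(b0 <= b < B) A * (L%:R * y b `^ (- alpha^-1)))).
  rewrite big_nat [leRHS]big_nat; apply: ler_sum => b /andP[b0b bB].
  apply: (@le_trans _ _ (tau b)); last by apply: tau_le; exact: leq_trans b0b.
  move: pw; rewrite /block_events -bigcap_seq => /(_ b); apply.
  by rewrite /= mem_index_iota b0b.
rewrite -mulr_sumr ler_wpM2l// (le_trans (block_sum b0B))//.
by apply: power_sum_nd; rewrite BE /= leq_trunc_div.
Qed.

End FromBlock.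

Lemma tilde_prod_unbounded (M : R) : g n @[n --> \oo] --> +oo ->
  exists N, forall n, (N <= n)%N -> M <= tilde_prod R f n.
Proof.
have [t Mt] : exists t : nat, M < t%:R by exists (Num.truncn M).+1; exact: truncnS_gt.
move=> /cvgryPge /(_ 2) [N _ HN]; exists (N + t)%N => n Nn.
(* Here [g 0] is the default value 1. *)
have p1 : 1 <= tilde_prod R f N by have := tilde_prod_growth 0 N; rewrite /= expr1n mulr1.
have := tilde_prod_growth N (n - N); rewrite subnKC; last by lia.
apply: le_trans; rewrite (@le_trans _ _ (2 ^+ (n - N)))//; last first.
  rewrite -[leLHS]mul1r ler_pM ?exprn_ge0// lerXn2r ?nnegrE// ?(HN N)//=.
  by rewrite ltW// tilde_growth_gt0.
rewrite (@le_trans _ _ (n - N)%:R)//.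
  rewrite ltW// (lt_le_trans Mt)// ler_nat; lia.
by rewrite -natrX ler_nat ltnW// ltn_expl.
Qed.

Lemma passage_upper_bound : g n @[n --> \oo] --> +oo ->
  {ae P, forall w, exists K0, forall n, min_time n w <= K0 + A * sigma n}.
Proof.
move=> gy; pose S b := surviving_event (b + b1.+1).
have b1b b : (b1 <= b + b1.+1)%N by rewrite (leq_trans (leqnSn _))// leq_addl.
have b0b b : (0 < b + b1.+1)%N by rewrite addnS.
have mS b : measurable (S b) by exact: measurable_surviving_event.
exists (\bigcap_b ~` S b); split.
- by apply: bigcap_measurable => // b _; exact: measurableC.
- apply/eqP; rewrite eq_le measure_ge0 andbT.
  (* The exceptional set avoids every [S b], and the complement of [S b] has probability at most [D]
     over [p] at the starting level, which tends to 0. *)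
  apply/lee_addgt0Pr => eps eps0; rewrite add0e.
  pose D := 2 * L%:R * C ^+ (2 * L).
  have [N HN] := tilde_prod_unbounded (D / eps) gy.
  have Nb : (N <= (N + b1.+1) * L)%N by rewrite (leq_trans _ (leq_pmulr _ L_gt0))// leq_addr.
  apply: (@le_trans _ _ (P (~` S N))).
    apply: le_measure; try apply: mem_set.
    + by apply: bigcap_measurable => // b _; exact: measurableC.
    + exact: measurableC.
    + exact: bigcap_inf.
  rewrite probability_setC// leeBlDr ?fin_num_measure//.
  have := surviving_event_prob (b1b N); rewrite -/(S N) => H.
  apply: (@le_trans _ _ (eps%:E + (1 - eps)%:E)%E).
    by rewrite -EFinD lee_fin; lra.
  rewrite leeD2l// (le_trans _ H)// lee_fin lerD2l lerN2.
  have p0 := tilde_prod_gt0 R f_gt0 ((N + b1.+1) * L).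
  rewrite mulrA ler_pdivrMr// [leRHS]mulrC -ler_pdivrMr//.
  exact: HN.
move=> w /= Hw b _ Sw; apply: Hw; exact: (surviving_min_time (b1b b) (b0b b) Sw).
Qed.

End UpperBound.

(** * Explosion and limits *)

Section RatioLimits.
Context {R : realType}.
Variables (M sigma : nat -> R) (kappa : R).
Hypothesis sigma_cvgy : sigma n @[n --> \oo] --> +oo.
(** Countably many tolerances tending to 1, so that a single null set serves them all. *)
Let u (k : nat) : R := 1 + k.+1%:R^-1.

Let u_cvg : u @ \oo --> (1 : R).
Proof.
rewrite -[X in _ --> X]addr0; apply: cvgD; first exact: cvg_cst.
exact: cvg_harmonic.
Qed.

Let sigma_large (a b : R) : 0 < b -> \forall n \near \oo, a <= b * sigma n.
Proof.
move=> b0; move/cvgryPge : sigma_cvgy => /(_ (a / b)); apply: filterS => n.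
by rewrite ler_pdivrMr// mulrC.
Qed.

Let sigma_gt0 : \forall n \near \oo, 0 < sigma n.
Proof. by move/cvgryPgt : sigma_cvgy; exact. Qed.

Lemma ratio_upper : (forall k, exists K0, forall n, M n <= K0 + u k ^+ 4 * kappa * sigma n) ->
  forall eps, 0 < eps -> \forall n \near \oo, M n / sigma n <= kappa + eps.
Proof.
move=> H eps eps0.
have : (fun k => u k ^+ 4 * kappa) @ \oo --> kappa.
  rewrite -[X in _ --> X]mul1r -(expr1n _ 4); apply: cvgM; last exact: cvg_cst.
  exact: (cvg_comp u (fun x : R => x ^+ 4) u_cvg (@exprn_continuous _ 4 1)).
move=> /cvgr_lt /(_ (kappa + eps / 2)); rewrite ltrDl divr_gt0// => /(_ isT)[k _ /(_ k)].
rewrite /= leqnn => /(_ isT) uk.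
have [K0 HK] := H k.
have e2 : 0 < eps / 2 by rewrite divr_gt0.
near=> n.
have s0 : 0 < sigma n by near: n.
have K0n : K0 <= eps / 2 * sigma n by near: n; exact: sigma_large.
rewrite ler_pdivrMr// (le_trans (HK n))//.
have := ler_wpM2r (ltW s0) (ltW uk); lra.
Unshelve. all: by end_near. Qed.

Lemma ratio_lower (good : nat -> nat -> Prop) :
  (forall k, exists (K0 : R) (N0 : nat), forall n, (N0 <= n)%N -> good k n ->
    kappa / u k * sigma n - K0 <= M n) ->
  forall eps, 0 < eps -> exists k, \forall n \near \oo,
    good k n -> kappa - eps <= M n / sigma n.
Proof.
move=> H eps eps0.
have : (fun k => kappa / u k) @ \oo --> kappa.
  rewrite -[X in _ --> X]mulr1 -(invr1 R); apply: cvgM; first exact: cvg_cst.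
  by apply: cvgV u_cvg; rewrite oner_neq0.
move=> /cvgr_gt /(_ (kappa - eps / 2)); rewrite gtrBl divr_gt0// => /(_ isT)[k _ /(_ k)].
rewrite /= leqnn => /(_ isT) uk; exists k.
have [K0 [N0 HK]] := H k.
have e2 : 0 < eps / 2 by rewrite divr_gt0.
near=> n => gn.
have s0 : 0 < sigma n by near: n.
have K0n : K0 <= eps / 2 * sigma n by near: n; exact: sigma_large.
have N0n : (N0 <= n)%N by near: n; exact: nbhs_infty_ge.
rewrite ler_pdivlMr// (le_trans _ (HK n N0n gn))//.
have := ler_wpM2r (ltW s0) (ltW uk); lra.
Unshelve. all: by end_near. Qed.

End RatioLimits.

Lemma limn_esup_eq {R : realType} (x : nat -> R) (l : R) :
  (forall eps, 0 < eps -> \forall n \near \oo, x n <= l + eps) ->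
  (forall eps N, 0 < eps -> exists2 n, (N <= n)%N & l - eps <= x n) ->
  limn_esup (fun n => (x n)%:E) = l%:E.
Proof.
move=> ub lb; apply/eqP; rewrite eq_le; apply/andP; split.
  apply/lee_addgt0Pr => eps eps0; have [N _ HN] := ub _ eps0.
  apply: (@le_trans _ _ (ereal_sup ((fun n => (x n)%:E) @` [set n | (N <= n)%N]))).
    by apply: ereal_inf_lbound; exists [set n | (N <= n)%N] => //; exists N.
  by apply: ge_ereal_sup => _ [n Nn <-]; rewrite -EFinD lee_fin; exact: HN.
apply: le_ereal_inf_tmp => _ [A [N _ HN] <-]; apply/lee_addgt0Pr => eps eps0.
have [n Nn xn] := lb _ N eps0.
apply: (@le_trans _ _ ((x n)%:E + eps%:E)%E).
  by rewrite -EFinD lee_fin -lerBlDr.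
rewrite leeD2r//; apply: ereal_sup_ubound; exists n => //; exact: HN.
Qed.

(** * Almost sure bounds with explicit constants *)

Section Percolation.
Context {R : realType} {V : choiceType} (e : rel V) (rho : V) (f : nat -> nat)
  {d : measure_display} {Omega : measurableType d} (P : probability Omega R)
  (X : V -> {RV P >-> R}) (G : R -> R) (alpha c : R).
Hypothesis tree_e : is_tree e.
Hypothesis sym_f : spherically_symmetric e rho f.
Hypothesis f_gt0 : forall n, (1 <= n)%N -> (1 <= f n)%N.
Hypothesis X_ge0 : forall v omega, 0 <= X v omega.
Hypothesis X_indep : independent_RVs P X.
Hypothesis X_cdf : common_cdf P X G.
Hypothesis alpha_gt0 : 0 < alpha.
Hypothesis c_gt0 : 0 < c.
Hypothesis hG : G t * t `^ (- alpha) @[t --> 0^'+] --> c.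

Local Notation g := (tilde_growth R f).
Local Notation M := (min_passage_time e rho X).
Local Notation sigma := (power_sum alpha g).
Local Notation C := (c * Gamma (1 + alpha)).
Local Notation kappa := (alpha * expR (- 1) * C `^ (- alpha^-1)).

Let G_ge0 := common_cdf_ge0 rho X_cdf.
Let G_le1 := common_cdf_le1 rho X_cdf.
Let G_nd := common_cdf_nd rho X_cdf.
Let lapE := laplaceE G_ge0 G_le1 G_nd alpha_gt0 c_gt0 hG.
Let lap_cvg := laplace_cvg G_ge0 G_le1 G_nd alpha_gt0 c_gt0 hG.

Let C_gt0 : 0 < C. Proof. by rewrite mulr_gt0// Gamma_gt0. Qed.

Let kappa_gt0 : 0 < kappa.
Proof. by rewrite !mulr_gt0 ?expR_gt0 ?powR_gt0. Qed.

Let g_gt0 n : 0 < g n. Proof. exact: tilde_growth_gt0. Qed.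

Let g_block_cvgy L : (0 < L)%N -> g n @[n --> \oo] --> +oo ->
  g (n * L) @[n --> \oo] --> +oo.
Proof.
move=> L0 /cvgryPge gy; apply/cvgryPge => A; have [N _ HN] := gy A.
by exists N => // n Nn; apply: HN => /=; rewrite (leq_trans Nn)// leq_pmulr.
Qed.

Lemma min_time_upper (u : R) : 1 < u -> g n @[n --> \oo] --> +oo ->
  {ae P, forall w, exists K0, forall n, M n w <= K0 + u ^+ 4 * kappa * sigma n}.
Proof.
move=> u1 gy; have u0 : 0 < u by exact: lt_trans u1.
have [L L0 HL] := block_asymptotics alpha_gt0 C_gt0 u1 lap_cvg.
have [b1 _ Hb] := HL _ (fun n => g_gt0 (n * L)) (g_block_cvgy L0 gy).
have K0 := tilt_rate_gt0 alpha C_gt0 u1.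
set K := tilt_rate alpha C u in Hb K0.
pose A := alpha * u / K.
have A0 : 0 < A by rewrite divr_gt0// mulr_gt0.
(* Three powers of [u] come from [tilt_rate], one from the margin in [tau]. *)
have -> : u ^+ 4 * kappa = A.
  rewrite /A /K /tilt_rate expRN powRN; field.
  by rewrite !gt_eqF ?expR_gt0 ?powR_gt0.
pose tau b := A * (L%:R * g (b * L) `^ (- alpha^-1)).
have L0' : 0 < L%:R :> R by rewrite ltr0n.
have tau0 b : 0 < tau b by rewrite /tau mulr_gt0// mulr_gt0// powR_gt0.
have [D D0 HD] := cdf_power_bound G_le1 alpha_gt0 c_gt0 hG.
pose D' := Num.max 1 (D * (A * L%:R) `^ alpha).
apply: (@passage_upper_bound R V e rho f d Omega P X G alpha tree_e sym_f f_gt0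
  X_ge0 X_indep X_cdf alpha_gt0 L tau b1 D' A) => //.
- by rewrite le_max lexx.
- exact: ltW.
- move=> b s b1b us sL; apply: (le_trans (Hb b b1b)) => /=.
  rewrite ler_wpM2l ?exprn_ge0 ?(ltW (g_gt0 _))//.
  set lam := K * _; have lam0 : 0 < lam by rewrite mulr_gt0// powR_gt0.
  (* Since [lam * tau b = alpha L u], the tilted passage time is centred near
     [alpha L / lam = tau b / u], strictly between [theta = u ^- 3 * tau b] and [tau b]. *)
  have H := @block_prob_lower R V rho d Omega P X G X_ge0 X_indep X_cdf lapE s
    lam (lam / u) (lam * u) (u ^- 3 * tau b) (tau b) us.
  have lamtau : lam * tau b = alpha * L%:R * u.
    rewrite /lam /tau /A powRN; field.
    by rewrite !gt_eqF ?powR_gt0.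
  have {}H := H (divr_gt0 lam0 u0) (_ : lam / u <= lam) (_ : lam <= lam * u).
  rewrite sL in H; apply: le_trans (H _ _); last 2 first.
  + by rewrite ler_pdivrMr// ler_peMr// ltW.
  + by rewrite ler_peMr// ltW.
  have -> : lam * (u ^- 3 * tau b) = alpha * L%:R * u ^- 2.
    by rewrite mulrCA lamtau; field; rewrite gt_eqF.
  have -> : (lam - lam / u) * tau b = alpha * L%:R * (u - 1).
    by transitivity (lam * tau b * (1 - u^-1)); [ring|rewrite lamtau; field; rewrite gt_eqF].
  have -> : (lam * u - lam) * (u ^- 3 * tau b) = alpha * L%:R * ((u - 1) * u ^- 2).
    by transitivity (lam * tau b * ((u - 1) * u ^- 3)); [ring|rewrite lamtau; field; rewrite gt_eqF].
  exact: lexx.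
- move=> b _; apply: (le_trans (HD _ (tau0 b))); rewrite /tau mulrA.
  have AL0 : 0 < A * L%:R by rewrite mulr_gt0.
  rewrite powRM ?powR_ge0 ?(ltW AL0)//.
  rewrite -powRrM mulNr mulVf ?gt_eqF// powR_inv1 ?(ltW (g_gt0 _))// mulrA.
  by rewrite ler_wpM2r ?invr_ge0 ?(ltW (g_gt0 _))// le_max lexx orbT.
Qed.

Definition almost_contact (q : R) n :=
  (level_size f n)%:R <= q ^+ n * tilde_prod R f n.

Lemma min_time_lower (u : R) : 1 < u -> g n @[n --> \oo] --> +oo ->
  {ae P, forall w, exists (K0 : R) (N0 : nat), forall n, (N0 <= n)%N ->
    almost_contact (u `^ (alpha / 2)) n -> kappa / u * sigma n - K0 <= M n w}.
Proof.
move=> u1 gy; have u0 : 0 < u by exact: lt_trans u1.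
(* At the critical rate times [u], [e^alpha g phi] tends to [u ^ - alpha]. This gain is split
   evenly: [q = u ^ (alpha / 2)] is spent on the almost-contact tolerance, and a limit
   [1 / q < r < 1] remains. *)
pose K := expR 1 * C `^ alpha^-1 * u.
have K0 : 0 < K by rewrite !mulr_gt0 ?expR_gt0 ?powR_gt0.
have a2 : 0 < alpha / 2 by rewrite divr_gt0.
have ua1 : 1 < u `^ (alpha / 2).
  have := gt0_ltr_powR a2 (_ : 1 \in Num.nneg) (_ : u \in Num.nneg) u1.
  by rewrite powR1; apply; rewrite nnegrE// ltW.
set q := u `^ _ in ua1 *; have q0 : 0 < q by exact: lt_trans ua1.
pose r := (1 + q^-1) / 2.
have q1 : q^-1 < 1 by rewrite invf_lt1.
have qV0 : 0 < q^-1 by rewrite invr_gt0.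
have r01 : 0 < r < 1 by rewrite /r; apply/andP; split; lra.
have qr : q^-1 < r by rewrite /r; lra.
pose lam n := K * g n.+1 `^ alpha^-1.
have lam0 n : 0 < lam n by rewrite mulr_gt0// powR_gt0.
have lamy : lam n @[n --> \oo] --> +oo.
  apply/cvgryPge => A; pose m := Num.max (A / K) 0.
  have m0 : 0 <= m by rewrite le_max lexx orbT.
  move/cvgryPge : gy => /(_ (m `^ alpha)) [N _ HN]; exists N => // n Nn /=.
  rewrite /lam mulrC -ler_pdivrMr//.
  apply: (@le_trans _ _ m); first by rewrite le_max lexx.
  rewrite -[leLHS]powRr1// -(divff (lt0r_neq0 alpha_gt0)) powRrM.
  apply: ge0_ler_powR; rewrite ?nnegrE ?invr_ge0 ?powR_ge0 ?(ltW alpha_gt0) ?(ltW (g_gt0 _))//.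
  by apply: HN => /=; exact: leqW.
have cv : (fun n => q * expR alpha * g n.+1 * laplace G (lam n)) @ \oo --> q^-1.
  have lim := lap_cvg lam0 lamy.
  rewrite (_ : (fun n => _) = (fun n => q * expR alpha / K `^ alpha *
      (laplace G (lam n) * lam n `^ alpha))).
    rewrite (_ : q^-1 = q * expR alpha / K `^ alpha * C).
      by apply: cvgM => //; exact: cvg_cst.
    have -> : K `^ alpha = expR alpha * C * (q * q).
      move: C_gt0; rewrite /K /q; move: C => C1 C10.
      rewrite powRM ?mulr_ge0 ?expR_ge0 ?powR_ge0 ?(ltW u0)//.
      rewrite powRM ?expR_ge0 ?powR_ge0//.
      rewrite -[(C1 `^ _) `^ _]powRrM mulVf ?gt_eqF// powRr1 ?(ltW C10)//.
      rewrite -powRD; last by apply/implyP => _; rewrite gt_eqF.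
      by rewrite -splitr {1}/powR gt_eqF ?expR_gt0// expRK mulr1.
    by field; rewrite !gt_eqF ?expR_gt0// Gamma_gt0.
  apply/funext => n; rewrite /lam powRM ?powR_ge0 ?(ltW K0)//.
  rewrite -[(_ `^ alpha^-1) `^ _]powRrM mulVf ?gt_eqF// powRr1 ?(ltW (g_gt0 _))//.
  by field; rewrite gt_eqF// powR_gt0.
have [N _ HN] := cvgr_lt _ cv _ qr.
have := @passage_lower_bound R V e rho f d Omega P X G alpha tree_e sym_f f_gt0
  X_ge0 X_indep X_cdf alpha_gt0 lapE K q r N K0 (ltW ua1) r01.
move=> /(_ (fun j Nj => ltW (HN j Nj))).
have -> : alpha / K = kappa / u.
  rewrite /K expRN powRN; field.
  by rewrite !gt_eqF ?expR_gt0 ?powR_gt0.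
exact.
Qed.

Lemma no_explosion : sigma n @[n --> \oo] --> +oo ->
  {ae P, forall w, ~ explosion e rho X w}.
Proof.
move=> sy; have [D D0 HD] := laplace_le G_ge0 G_le1 G_nd alpha_gt0 c_gt0 hG.
have E0 : 0 < 4 * expR alpha * D by rewrite !mulr_gt0 ?expR_gt0.
(* With tolerance [q = 2], the uniform bound on [laplace] makes each factor at most
   [2 e^alpha D / K ^ alpha = 1/2], at every level. *)
pose K := (4 * expR alpha * D) `^ alpha^-1.
have K0 : 0 < K by exact: powR_gt0.
have r01 : 0 < (2^-1 : R) < 1 by apply/andP; split; lra.
have H := @passage_lower_bound R V e rho f d Omega P X G alpha tree_e sym_f f_gt0
  X_ge0 X_indep X_cdf alpha_gt0 lapE K 2 2^-1 0 K0 (ler1n _ 2) r01.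
have : {ae P, forall w, exists (K0 : R) (N0 : nat), forall n, (N0 <= n)%N ->
    (level_size f n)%:R <= 2 ^+ n * tilde_prod R f n ->
    alpha / K * power_sum alpha g n - K0 <= M n w}.
  apply: H => j _; have lam0 : 0 < K * g j.+1 `^ alpha^-1 by rewrite mulr_gt0// powR_gt0.
  apply: (le_trans (ler_wpM2l _ (HD _ lam0))).
    by rewrite !mulr_ge0 ?expR_ge0 ?(ltW (g_gt0 _)).
  rewrite powRN powRM ?powR_ge0 ?(ltW K0)// -!powRrM mulVf ?gt_eqF//.
  rewrite !powRr1 ?(ltW E0) ?(ltW (g_gt0 _))// le_eqVlt; apply/orP; left; apply/eqP.
  by field; rewrite !gt_eqF ?expR_gt0.
apply: filterS => w [K1 [N0 HN]] [B HB].
have aK : 0 < alpha / K by rewrite divr_gt0.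
move/cvgryPgt : sy => /(_ ((B + K1) / (alpha / K))) [N _ HNs].
have two1 : (1 : R) < 2 by rewrite ltr1n.
have [n Nn gn] := tilde_almost_contact f_gt0 (maxn N N0) two1.
have N0n : (N0 <= n)%N by rewrite (leq_trans (leq_maxr N N0))// ltnW.
have Nn' : (N <= n)%N by rewrite (leq_trans (leq_maxl N N0))// ltnW.
have h1 := HN n N0n gn; have h2 : M n w <= B by apply: HB; exists n.
have := HNs n Nn'; rewrite /= ltr_pdivrMr// mulrC => h3; lra.
Qed.

Let sigma_nd : nondecreasing_seq sigma.
Proof. by move=> m n; exact: power_sum_nd. Qed.

Lemma sigma_dvgy : ~ cvgn sigma -> sigma n @[n --> \oo] --> +oo.
Proof. by move=> ?; apply: nondecreasing_dvgn_lt. Qed.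

(** The terms of a convergent series tend to 0. This supplies the growth assumption of
    [min_time_upper] in the explosive case. *)
Lemma sigma_cvg_growth : cvgn sigma -> g n @[n --> \oo] --> +oo.
Proof.
move=> cs; have : series (fun n => g n.+1 `^ (- alpha^-1)) = sigma.
  by apply/funext => n; rewrite power_sumE /series /= big_mkord.
move=> E; have : (fun n => g n.+1 `^ (- alpha^-1)) @ \oo --> (0 : R).
  by apply: cvg_series_cvg_0; rewrite E.
move=> c0; apply/cvgryPge => A; pose m := Num.max A 1.
have m0 : 0 < m by rewrite lt_max ltr01 orbT.
have mp : 0 < m `^ (- alpha^-1) by exact: powR_gt0.
have [N _ HN] := cvgr_lt _ c0 _ mp.
exists N.+1 => // -[//|n] Nn.
have : g n.+1 `^ (- alpha^-1) < m `^ (- alpha^-1) := HN n Nn.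
rewrite !powRN ltf_pV2 ?posrE ?powR_gt0// => h.
apply: (@le_trans _ _ m); first by rewrite le_max lexx.
rewrite leNgt; apply/negP => gm; move: h; rewrite ltNge => /negP; apply.
by apply: ge0_ler_powR; rewrite ?nnegrE ?invr_ge0 ?(ltW alpha_gt0) ?(ltW (g_gt0 _)) ?(ltW m0) ?(ltW gm).
Qed.

Lemma explosion_criterion : {ae P, forall w, explosion e rho X w} <-> cvgn sigma.
Proof.
split=> [ex|cs].
  apply: contrapT => ns; have nex := no_explosion (sigma_dvgy ns).
  have PF : ProperFilter (almost_everywhere P).
    apply: ae_properfilter_algebraOfSetsType.
    have PT : (P setT = 1)%E := probability_setT P.
    by apply: (@lt_le_trans _ _ 1%E); rewrite ?lte01// -PT.
  by have [w [h1 h2]] := filter_ex (filterI ex nex); exact: h2.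
have u1 : (1 : R) < 2 by rewrite ltr1n.
apply: filterS (min_time_upper u1 (sigma_cvg_growth cs)) => w [K0 HK].
exists (K0 + 2 ^+ 4 * kappa * limn sigma) => _ [n _ <-].
apply: (le_trans (HK n)); rewrite lerD2l ler_wpM2l//.
  by rewrite mulr_ge0 ?exprn_ge0// ltW.
exact: nondecreasing_cvgn_le.
Qed.

Lemma ae_ratio : g n @[n --> \oo] --> +oo -> ~ cvgn sigma ->
  {ae P, forall w,
    (forall eps, 0 < eps -> \forall n \near \oo, M n w / sigma n <= kappa + eps) /\
    (forall eps, 0 < eps -> exists2 q, 1 < q & \forall n \near \oo,
       almost_contact q n -> kappa - eps <= M n w / sigma n)}.
Proof.
move=> gy /sigma_dvgy sy; pose u (k : nat) : R := 1 + k.+1%:R^-1.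
have u1 k : 1 < u k by rewrite ltrDl invr_gt0.
have up : {ae P, forall w, forall k, exists K0, forall n,
    M n w <= K0 + u k ^+ 4 * kappa * sigma n}.
  by apply/ae_foralln => k; exact: min_time_upper.
have low : {ae P, forall w, forall k, exists (K0 : R) (N0 : nat), forall n, (N0 <= n)%N ->
    almost_contact (u k `^ (alpha / 2)) n -> kappa / u k * sigma n - K0 <= M n w}.
  by apply/ae_foralln => k; exact: min_time_lower.
apply: filterS2 up low => w upw loww; split=> eps eps0.
  have := @ratio_upper R (fun n => M n w) sigma kappa sy upw eps eps0.
  exact.
have [k Hk] := @ratio_lower R (fun n => M n w) sigma kappa sy (fun k => almost_contact (u k `^ (alpha / 2))) loww eps eps0.
exists (u k `^ (alpha / 2)) => //.
have := gt0_ltr_powR (divr_gt0 alpha_gt0 (ltr0n R 2)) (_ : 1 \in Num.nneg) (_ : u k \in Num.nneg) (u1 k).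
by rewrite powR1; apply; rewrite nnegrE// ltW// (lt_trans _ (u1 k)).
Qed.

End Percolation.

Unset Implicit Arguments.

(* The two limit clauses assume that f, resp. its tilde version, tends to
   infinity: for bounded f they fail (f = 1 everywhere and X exponential of
   rate 1 give M_n / n --> 1, not 1 / e). The explosion criteria do not. *)
Theorem proposition7 (R : realType)
  (V : choiceType) (e : rel V) (rho : V) (f : nat -> nat)
  (he : is_tree e) (hV : infinite_set [set: V])
  (hf : forall n, (1 <= n)%N -> (1 <= f n)%N)
  (hef : spherically_symmetric e rho f)
  (d : measure_display) (Omega : measurableType d) (P : probability Omega R)
  (X : V -> {RV P >-> R}) (G : R -> R) (alpha c : R)
  (X_ge0 : forall v omega, 0 <= X v omega)
  (X_indep : independent_RVs P X) (X_cdf : common_cdf P X G)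
  (alpha_gt0 : 0 < alpha) (c_gt0 : 0 < c)
  (hG : G t * t `^ (- alpha) @[t --> 0^'+] --> c) :
  let M := min_passage_time e rho X in
  let kappa := alpha * expR (- 1) * (c * Gamma (1 + alpha)) `^ (- alpha^-1) in
  let fR : nat -> R := fun n => (f n)%:R in
  let ft : nat -> R := tilde_growth R f in
  ((forall m n, (1 <= m)%N -> (m <= n)%N -> (f m <= f n)%N) ->
    ({ae P, forall omega, explosion e rho X omega} <->
       cvgn (power_sum alpha fR)) /\
    (f n @[n --> \oo] --> \oo -> ~ cvgn (power_sum alpha fR) ->
       {ae P, forall omega,
          M n omega / power_sum alpha fR n @[n --> \oo] --> kappa})) /\
  (({ae P, forall omega, explosion e rho X omega} <->
      cvgn (power_sum alpha ft)) /\
   (ft n @[n --> \oo] --> +oo -> ~ cvgn (power_sum alpha ft) ->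
      {ae P, forall omega,
         limn_esup (fun n => (M n omega / power_sum alpha ft n)%:E) =
         kappa%:E})).
Proof.
move=> M kappa fR ft.
have E := explosion_criterion he hef hf X_ge0 X_indep X_cdf alpha_gt0 c_gt0 hG.
have L := ae_ratio he hef hf X_ge0 X_indep X_cdf alpha_gt0 c_gt0 hG.
split=> [f_nd|]; last first.
  split=> // fty ndv; apply: filterS (L fty ndv) => w [ub lb].
  apply: limn_esup_eq => // eps N eps0; have [q q1 [N1 _ HN]] := lb eps eps0.
  (* Almost-contact levels beyond any [N] carry the lower bound, which is what a limsup requires. *)
  have [n Nn gn] := tilde_almost_contact hf (maxn N N1) q1.
  exists n; first by rewrite (leq_trans (leq_maxl N N1))// ltnW.
  by apply: HN => //=; rewrite (leq_trans (leq_maxr N N1))// ltnW.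
have ftE n : (1 <= n)%N -> ft n = (f n)%:R by exact: tilde_growth_nondecreasing.
have sE : power_sum alpha fR = power_sum alpha ft.
  apply/funext => n; rewrite !power_sumE; apply: eq_bigr => j _.
  by congr (_ `^ _); exact: esym (ftE j.+1 isT).
rewrite sE; split=> // fy ndv.
have fty : ft n @[n --> \oo] --> +oo.
  apply/cvgryPge => A; have [K AK] : exists K : nat, A < K%:R by exists (Num.truncn A).+1; exact: truncnS_gt.
  move/cvgnyPge : fy => /(_ K) [N _ HN]; exists N.+1 => // n Nn.
  rewrite ftE; last by exact: leq_ltn_trans Nn.
  by rewrite (le_trans (ltW AK))// ler_nat HN//=; exact: ltnW.
(* For nondecreasing [f] the minorant equals the level size, so the lower bound holds at all large
   levels and the limsup becomes a limit. *)
have contact q n : 1 < q -> almost_contact (R := R) f q n.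
  move=> q1; rewrite /almost_contact tilde_prodE.
  rewrite (_ : \prod_(1 <= i < n.+1) _ = (level_size f n)%:R).
    by rewrite ler_peMl// exprn_ege1// ltW.
  by rewrite /level_size natr_prod big_nat [RHS]big_nat; apply: eq_bigr => i /andP[i1 _]; exact: ftE.
apply: filterS (L fty ndv) => w [ub lb].
apply/cvgrPdist_le => eps eps0; have [q q1 Hq] := lb eps eps0.
near=> n; rewrite distrC ler_norml lerBlDl; apply/andP; split.
  rewrite lerBrDl.
  by have : almost_contact f q n -> kappa - eps <= M n w / power_sum alpha ft n; [near: n|apply; exact: contact].
by near: n; exact: ub.
Unshelve. all: by end_near. Qed.
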